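(* Let $\mathbf{k}$ be an algebraically closed field of characteristic $p>0$ and $n\in\mathbb{Z}_{>0}$. Every completely splittable $\mathbf{k}S_n$-module is algebraic.
   Context: A simple (finite-dimensional) $\mathbf{k}S_n$-module is completely splittable if its restriction to every Young subgroup $S_\lambda=S_{\lambda_1}\times\cdots\times S_{\lambda_l}<S_n$ (for a composition $\lambda\vDash n$) is semisimple. A finite-dimensional module $M$ of a finite group $G$ over $\mathbf{k}$ is algebraic if only finitely many isomorphism classes of indecomposable modules appear as direct summands of the tensor powers $M^{\otimes j}$, $j\ge 0$ (with diagonal $G$-action); equivalently, its class in the Green ring of $G$ satisfies a non-trivial polynomial identity. *)

(* Defs.v *)
From HB Require Import structures.
From mathcomp Require Import all_boot all_order all_algebra all_fingroup.
From mathcomp Require Import all_solvable all_field all_character.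

Set Implicit Arguments.
Unset Strict Implicit.
Unset Printing Implicit Defensive.

Import GroupScope.

(* Finite-dimensional modules over the group algebra are matrix
   representations, bundled with their degree; isomorphism is mx_rsim. *)

Section FiniteGroup.

Variables (F : fieldType) (gT : finGroupType) (G : {group gT}).

Lemma trivial_mx_repr : mx_repr G (fun _ : gT => (1%:M)%R : 'M[F]_1).
Proof. by split=> // g h _ _; rewrite mulmx1. Qed.

Definition trivial_grepr : representation F G :=
  Representation (MxRepresentation trivial_mx_repr).

Definition tensor_power (M : representation F G) (j : nat) :
    representation F G :=
  iter j (fun N : representation F G => Representation (prod_repr M N)) trivial_grepr.

Definition direct_summand (N M : representation F G) : Prop :=
  exists N' : representation F G, mx_rsim M (dadd_grepr N N').

Definition indecomposable (M : representation F G) : Prop :=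
  0 < rdegree M /\
  forall N1 N2 : representation F G,
    mx_rsim M (dadd_grepr N1 N2) -> rdegree N1 = 0 \/ rdegree N2 = 0.

Definition algebraic_module (M : representation F G) : Prop :=
  exists (m : nat) (L : 'I_m -> representation F G),
  forall (j : nat) (N : representation F G),
    indecomposable N -> direct_summand N (tensor_power M j) ->
    exists i : 'I_m, mx_rsim N (L i).

End FiniteGroup.

Definition composition (n : nat) (lam : seq nat) : bool :=
  all (fun a => 0 < a) lam && (sumn lam == n).

Definition young_block (n : nat) (lam : seq nat) (k : nat) : {set 'I_n} :=
  [set i : 'I_n | sumn (take k lam) <= i < sumn (take k.+1 lam)].

(* The product in Group_scope is the generated subgroup; since the blocks are
   pairwise disjoint, it is the internal direct product of the factors. *)
Definition young_subgroup (n : nat) (lam : seq nat) : {group 'S_n} :=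
  (\prod_(k < size lam) perm.Sym_group (young_block n lam k))%G.

(* mxsemisimple is informative (it carries the simple summands). *)
Definition completely_splittable (F : fieldType) (n : nat)
    (M : representation F [set: 'S_n]) : Prop :=
  mx_irreducible M /\
  forall lam : seq nat, composition n lam ->
    inhabited (mxsemisimple
      (subg_repr M (subsetT (young_subgroup n lam))) 1%:M%R).

(* Main.v *)
Require Import Defs.
From HB Require Import structures.
From Stdlib Require List.
From mathcomp Require Import all_boot all_order all_algebra all_fingroup.
From mathcomp Require Import all_solvable all_field all_character.
From Stdlib Require Import Classical.

Set Implicit Arguments.
Unset Strict Implicit.
Unset Printing Implicit Defensive.

Import GroupScope GRing.Theory.
Local Open Scope ring_scope.

(* Induction on [n], passing to a subgroup of ['S_n] of index prime to [p].

   If [n] is not a power of [p], let [q] be the largest power of [p] below [n]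
   and take [S_q x S_(n-q)]; if [n = p q] is a power of [p], take the wreath
   product of [S_q] by a cyclic group of order [p].  Both are wreath products
   of a base group [H = S_q] by a group [K] acting on a set [X] (a point, or
   [K] itself).

   On a module [M] of such a group, each factor [H] of the base acts through a
   separable algebra, as [M] is semisimple over [H] and the field is
   algebraically closed.  A separability idempotent is a tensor of elements
   [v_a], [u_a] of the group algebra of [H], and the [X]-fold products of these
   make [M] a direct summand of [E^(X) (x) W], where [E^(X)] is the tensor
   induction of the [H]-module [E] spanned by the [u_a], a summand of copies of
   [M], and [W] is the restriction of [M] to [K], inflated.  Tensor induction
   preserves algebraicity up to permutation modules of [K], and [W] is harmless
   because either [K = S_(n-q)] is covered by induction or [K] is cyclic of
   order [p] and has finitely many indecomposable modules, the Jordan blocks. *)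

(** * Matrices and representations indexed by finite types *)

(** Restriction need not preserve irreducibility; what survives of complete splittability is
    semisimplicity over the symmetric group of every subset. The induction therefore runs over
    [splittable] modules, a condition on all embedded symmetric groups which restrictions inherit.

    The choice of subgroups is dictated by Legendre's formula: if [q] is the largest power of [p]
    not exceeding [n], then adding [q] and [n - q] in base [p] produces no carry, and [(p q)!] has
    the same [p]-adic valuation as [q!^p p].

    The obstacle is that a module of a wreath product need not factor as a tensor product of a
    module built from the base and a module of the top. Being a summand of such a product is enough,
    since tensor powers of the module are then controlled by those of the two factors.

    Algebraicity is handled as domination by multiples of one fixed module, and direct summands as
    retracts. Both notions pass through tensor products, restriction, induction and tensor
    induction, so indecomposable modules enter only through Krull-Schmidt and through the Jordan
    blocks. *)

Section IndexedMatrices.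

Variable F : fieldType.

Local Notation "''FM_' ( A , B )" := 'M[F]_(#|A|, #|B|)
  (at level 0, A at level 2, B at level 2).

Definition ent (A B : finType) (M : 'FM_(A, B)) (a : A) (b : B) : F :=
  M (enum_rank a) (enum_rank b).

Definition mxf (A B : finType) (f : A -> B -> F) : 'FM_(A, B) :=
  \matrix_(i, j) f (enum_val i) (enum_val j).

Lemma entP (A B : finType) (M N : 'FM_(A, B)) :
  (forall a b, ent M a b = ent N a b) -> M = N.
Proof.
move=> eqMN; apply/matrixP=> i j.
by have:= eqMN (enum_val i) (enum_val j); rewrite /ent !enum_valK.
Qed.

Lemma ent_mxf (A B : finType) (f : A -> B -> F) a b : ent (mxf f) a b = f a b.
Proof. by rewrite /ent mxE !enum_rankK. Qed.

Lemma ent_mul (A B C : finType) (M : 'FM_(A, B)) (N : 'FM_(B, C)) a c :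
  ent (M *m N) a c = \sum_b ent M a b * ent N b c.
Proof.
rewrite /ent mxE (reindex enum_rank) //.
by exists enum_val => x _; rewrite ?enum_rankK ?enum_valK.
Qed.

Lemma ent1 (A : finType) (a b : A) : ent 1%:M a b = (a == b)%:R.
Proof. by rewrite /ent mxE (inj_eq enum_rank_inj). Qed.

Lemma ent_sum (A B I : finType) (M : I -> 'FM_(A, B)) a b :
  ent (\sum_i M i) a b = \sum_i ent (M i) a b.
Proof. by rewrite /ent summxE. Qed.

Lemma entZ (A B : finType) c (M : 'FM_(A, B)) a b :
  ent (c *: M) a b = c * ent M a b.
Proof. by rewrite /ent mxE. Qed.

Definition kron (A B A' B' : finType) (M : 'FM_(A, B)) (N : 'FM_(A', B')) :=
  mxf (fun (a : A * A') (b : B * B') => ent M a.1 b.1 * ent N a.2 b.2).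

Lemma kronM (A B C A' B' C' : finType) (M : 'FM_(A, B)) (M' : 'FM_(B, C))
    (N : 'FM_(A', B')) (N' : 'FM_(B', C')) :
  kron M N *m kron M' N' = kron (M *m M') (N *m N').
Proof.
apply: entP => -[a a'] [c c']; rewrite ent_mul ent_mxf /= !ent_mul.
rewrite big_distrlr /= pair_big /=.
by apply: eq_bigr => -[b b'] _; rewrite !ent_mxf /= mulrACA.
Qed.

Lemma kron1 (A B : finType) :
  kron (1%:M : 'FM_(A, A)) (1%:M : 'FM_(B, B)) = 1%:M.
Proof.
apply: entP => -[a a'] [b b']; rewrite ent_mxf !ent1 /= xpair_eqE.
by rewrite -natrM mulnb.
Qed.

(* The permutation [s] of the columns is that of a wreath product acting on a
   tensor power. *)
Definition tpw (X A B : finType) (M : X -> 'FM_(A, B)) (s : X -> X) :=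
  mxf (fun (f : {ffun X -> A}) (g : {ffun X -> B}) =>
    \prod_x ent (M x) (f x) (g (s x))).

(** The product over [x] of the matrix products expands into a sum over functions [X -> B];
    relabelling these functions along [s], which must be bijective, gives the product of the two
    operators. *)
Lemma tpwM (X A B C : finType) (M : X -> 'FM_(A, B)) (N : X -> 'FM_(B, C)) s t :
  bijective s ->
  tpw M s *m tpw N t = tpw (fun x => M x *m N (s x)) (t \o s).
Proof.
move=> [s' sK s'K]; have bij_s : bijective s by exists s'.
apply: entP => f h; rewrite ent_mul ent_mxf.
under [RHS]eq_bigr => x _ do rewrite ent_mul.
rewrite (bigA_distr_bigA (fun x b =>
  ent (M x) (f x) b * ent (N (s x)) b (h (t (s x))))).
rewrite (reindex (fun g : {ffun X -> B} => [ffun x => g (s' x)])) /=; last first.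
  exists (fun g : {ffun X -> B} => [ffun x => g (s x)]) => g _;
    by apply/ffunP=> x; rewrite !ffunE ?sK ?s'K.
apply: eq_bigr => g _; rewrite !ent_mxf [X in _ * X](reindex s) ?big_split /=;
  last exact: onW_bij.
by congr (_ * _); apply: eq_bigr => x _; rewrite ffunE sK.
Qed.

Lemma tpw1 (X A : finType) :
  tpw (fun _ : X => 1%:M : 'FM_(A, A)) id = 1%:M.
Proof.
apply: entP => f g; rewrite ent_mxf ent1.
have [->|/eqP neq_fg] := eqVneq f g.
  by apply: big1 => x _; rewrite ent1 eqxx.
have [x neq_x] : exists x, f x != g x.
  apply/existsP; rewrite -negb_forall; apply/negP=> /forallP eq_fg.
  by apply: neq_fg; apply/ffunP=> x; apply/eqP.
by rewrite (bigD1 x) //= ent1 (negPf neq_x) mul0r.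
Qed.

Definition bmx (A B : finType) (f : A -> B) : 'FM_(A, B) :=
  mxf (fun a b => (f a == b)%:R).

Lemma bmx_mul (A B C : finType) (f : A -> B) (M : 'FM_(B, C)) a c :
  ent (bmx f *m M) a c = ent M (f a) c.
Proof.
rewrite ent_mul (bigD1 (f a)) //= ent_mxf eqxx mul1r big1 ?addr0 // => b.
by rewrite ent_mxf eq_sym => /negPf->; rewrite mul0r.
Qed.

Lemma mul_bmx (A B C : finType) (f : A -> B) (f' : B -> A) (M : 'FM_(C, A)) :
  cancel f f' -> cancel f' f ->
  forall c b, ent (M *m bmx f) c b = ent M c (f' b).
Proof.
move=> fK f'K c b; rewrite ent_mul (bigD1 (f' b)) //= ent_mxf f'K eqxx mulr1.
rewrite big1 ?addr0 // => a; rewrite ent_mxf (can2_eq fK f'K) => /negPf->.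
by rewrite mulr0.
Qed.

Lemma bmxK (A B : finType) (f : A -> B) (f' : B -> A) :
  cancel f f' -> bmx f *m bmx f' = 1%:M.
Proof. by move=> fK; apply: entP => a b; rewrite bmx_mul ent_mxf fK ent1. Qed.

End IndexedMatrices.

(** * Representations, their direct summands and tensor powers *)

Section Representations.

Variable F : fieldType.

(* Allowing any finite type as basis lets tensor products and tensor induction
   be indexed by pairs and by functions. *)
Record frep (gT : finGroupType) := FRep {
  fB : finType;
  fR : gT -> 'M[F]_#|fB|;
  fR1 : fR 1%g = 1%:M;
  fRM : forall g h, fR (g * h)%g = fR g *m fR h }.

(** Up to isomorphism, [V] is a direct summand of [W]. Recording the inclusion and the projection,
    but no complement, lets every functor below preserve the relation by acting on the two
    matrices. *)
Definition ret (gT : finGroupType) (V W : frep gT) : Prop :=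
  exists (i : 'M[F]_(#|fB V|, #|fB W|)) (r : 'M[F]_(#|fB W|, #|fB V|)),
  [/\ forall g, fR V g *m i = i *m fR W g,
      forall g, fR W g *m r = r *m fR V g
    & i *m r = 1%:M].

Local Notation "V <| W" := (ret V W) (at level 70).

Section Fixed.
Variable gT : finGroupType.
Implicit Types U V W : frep gT.

Lemma fRK V g : fR V g^-1%g *m fR V g = 1%:M.
Proof. by rewrite -fRM mulVg fR1. Qed.

Lemma ret_refl V : V <| V.
Proof.
by exists 1%:M, 1%:M; split=> [g|g|]; rewrite ?mulmx1 ?mul1mx.
Qed.

Lemma ret_trans U V W : U <| V -> V <| W -> U <| W.
Proof.
move=> [i [r [hi hr ir]]] [i' [r' [hi' hr' ir']]].
exists (i *m i'), (r' *m r); split=> [g|g|].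
- by rewrite mulmxA hi -mulmxA hi' mulmxA.
- by rewrite mulmxA hr' -mulmxA hr mulmxA.
by rewrite mulmxA -[_ *m r']mulmxA ir' mulmx1.
Qed.

Lemma ret_bij V W (f : fB V -> fB W) :
    bijective f ->
    (forall g a b, ent (fR V g) a b = ent (fR W g) (f a) (f b)) -> V <| W.
Proof.
move=> [f' fK f'K] eqVW; exists (bmx F f), (bmx F f'); split=> [g|g|].
- apply: entP => a b; rewrite bmx_mul (mul_bmx _ fK f'K) eqVW.
  by rewrite f'K.
- apply: entP => a b; rewrite bmx_mul (mul_bmx _ f'K fK) eqVW.
  by rewrite f'K.
exact: bmxK.
Qed.

Lemma kron_fR1 V W : kron (fR V 1%g) (fR W 1%g) = 1%:M.
Proof. by rewrite !fR1 kron1. Qed.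

Lemma kron_fRM V W g h :
  kron (fR V (g * h)%g) (fR W (g * h)%g) =
  kron (fR V g) (fR W g) *m kron (fR V h) (fR W h).
Proof. by rewrite kronM !fRM. Qed.

Definition tens V W := FRep (kron_fR1 V W) (kron_fRM V W).

Lemma triv_fRM (A : finType) (g h : gT) : (1%:M : 'M[F]_#|A|) = 1%:M *m 1%:M.
Proof. by rewrite mulmx1. Qed.

(** Tensoring with [triv A] makes [#|A|] copies of a module; multiplicities are expressed in this
    way throughout. *)
Definition triv (A : finType) : frep gT :=
  FRep (erefl (1%:M : 'M[F]_#|A|)) (@triv_fRM A).

Definition tpow V j : frep gT := iter j (tens V) (triv unit).

Lemma ret_tens V V' W W' : V <| V' -> W <| W' -> tens V W <| tens V' W'.
Proof.
move=> [i [r [hi hr ir]]] [i' [r' [hi' hr' ir']]].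
exists (kron i i'), (kron r r'); split=> [g|g|] /=; rewrite !kronM.
- by rewrite hi hi'.
- by rewrite hr hr'.
by rewrite ir ir' kron1.
Qed.

Lemma ret_tpow V W j : V <| W -> tpow V j <| tpow W j.
Proof.
move=> VW; elim: j => [|j IHj]; first exact: ret_refl.
exact: ret_tens.
Qed.

Lemma ret_tensA U V W : tens (tens U V) W <| tens U (tens V W).
Proof.
apply: (ret_bij (f := fun x : fB (tens (tens U V) W) =>
  (x.1.1, (x.1.2, x.2)) : fB (tens U (tens V W)))).
  by exists (fun x : fB (tens U (tens V W)) => ((x.1, x.2.1), x.2.2));
    [case=> [[? ?] ?] | case=> [? [? ?]]].
by move=> g [[a b] c] [[a' b'] c']; rewrite ?ent_mxf /= ?ent_mxf /= mulrA.
Qed.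

Lemma ret_tensC U V : tens U V <| tens V U.
Proof.
apply: (ret_bij (f := fun x : fB (tens U V) => (x.2, x.1) : fB (tens V U))).
  by exists (fun x : fB (tens V U) => (x.2, x.1)); case.
by move=> g [a b] [a' b']; rewrite !ent_mxf /= mulrC.
Qed.

Lemma ret_tensACA U V U' V' :
  tens (tens U V) (tens U' V') <| tens (tens U U') (tens V V').
Proof.
apply: (ret_bij (f := fun x : fB (tens (tens U V) (tens U' V')) =>
  ((x.1.1, x.2.1), (x.1.2, x.2.2)) : fB (tens (tens U U') (tens V V')))).
  by exists (fun x : fB (tens (tens U U') (tens V V')) =>
    ((x.1.1, x.2.1), (x.1.2, x.2.2))); case=> [[? ?] [? ?]].
move=> g [[a b] [c d]] [[a' b'] [c' d']]; rewrite ?ent_mxf /= ?ent_mxf /=.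
by rewrite mulrACA.
Qed.

Lemma ret_triv_unit V : V <| tens V (triv unit).
Proof.
apply: (ret_bij (f := fun x : fB V => (x, tt) : fB (tens V (triv unit)))).
  by exists fst => [|[x []]].
by move=> g a b; rewrite ent_mxf /= ent1 eqxx mulr1.
Qed.

Lemma ret_triv_tens (A B : finType) : tens (triv A) (triv B) <| triv (A * B)%type.
Proof.
apply: (ret_bij (f := (id : fB (tens (triv A) (triv B)) ->
   fB (triv (A * B)%type)))); first by exists id.
move=> g [a b] [a' b']; rewrite ent_mxf /= !ent1 xpair_eqE.
by rewrite -natrM mulnb.
Qed.

Lemma ret_triv_tensC (A B : finType) V :
  tens (tens V (triv A)) (triv B) <| tens V (triv (A * B)%type).
Proof.
apply: ret_trans (ret_tensA _ _ _) _.
by apply: ret_tens; [exact: ret_refl | exact: ret_triv_tens].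
Qed.

Lemma tpow_tens V W j : tpow (tens V W) j <| tens (tpow V j) (tpow W j).
Proof.
elim: j => [|j IHj] /=; first exact: ret_triv_unit.
apply: ret_trans (ret_tens (ret_refl _) IHj) _.
exact: ret_tensACA.
Qed.

Lemma tpow_triv (A : finType) j : exists B : finType, tpow (triv A) j <| triv B.
Proof.
elim: j => [|j [B AB]] /=; first by exists unit; apply: ret_refl.
exists (A * B)%type; apply: ret_trans (ret_triv_tens _ _).
by apply: ret_tens => //; apply: ret_refl.
Qed.

(* By Krull-Schmidt, this gives the finiteness of the set of indecomposable
   summands of tensor powers: they are summands of [T]. *)
Definition algf V : Prop := exists T : frep gT,
  forall j, exists A : finType, tpow V j <| tens T (triv A).

Lemma algf_ret V W : V <| W -> algf W -> algf V.
Proof.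
move=> VW [T algT]; exists T => j; have [A TA] := algT j; exists A.
exact: ret_trans (ret_tpow j VW) TA.
Qed.

Lemma algf_triv V (A : finType) : algf V -> algf (tens V (triv A)).
Proof.
move=> [T algT]; exists T => j; have [B TB] := algT j.
have [C AC] := tpow_triv A j; exists (B * C)%type.
apply: ret_trans (tpow_tens _ _ _) _.
apply: ret_trans (ret_tens TB AC) _.
exact: ret_triv_tensC.
Qed.

Definition dsum_mx (A B A' B' : finType) (M : 'M[F]_(#|A|, #|B|))
    (N : 'M[F]_(#|A'|, #|B'|)) : 'M[F]_(#|{: A + A'}|, #|{: B + B'}|) :=
  mxf (fun x y => match x, y with
    | inl a, inl b => ent M a b
    | inr a, inr b => ent N a b
    | _, _ => 0 end).

Lemma dsum_mxM (A B C A' B' C' : finType) (M : 'M[F]_(#|A|, #|B|))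
    (M' : 'M[F]_(#|B|, #|C|)) (N : 'M[F]_(#|A'|, #|B'|))
    (N' : 'M[F]_(#|B'|, #|C'|)) :
  dsum_mx M N *m dsum_mx M' N' = dsum_mx (M *m M') (N *m N').
Proof.
apply: entP => -[a|a] [c|c]; rewrite ent_mul big_sumType /= !ent_mxf ?ent_mul.
- rewrite [X in _ + X]big1 ?addr0 => [|b _]; last by rewrite !ent_mxf mul0r.
  by apply: eq_bigr => b _; rewrite !ent_mxf.
- by rewrite !big1 ?addr0 // => b _; rewrite !ent_mxf ?mulr0 ?mul0r.
- by rewrite !big1 ?addr0 // => b _; rewrite !ent_mxf ?mulr0 ?mul0r.
rewrite big1 ?add0r => [|b _]; last by rewrite !ent_mxf mul0r.
by apply: eq_bigr => b _; rewrite !ent_mxf.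
Qed.

Lemma dsum_mx1 (A B : finType) :
  dsum_mx (1%:M : 'M[F]_#|A|) (1%:M : 'M[F]_#|B|) = 1%:M.
Proof. by apply: entP => -[a|a] [b|b]; rewrite ent_mxf ?ent1. Qed.

Lemma dsum_fR1 V W : dsum_mx (fR V 1%g) (fR W 1%g) = 1%:M.
Proof. by rewrite !fR1 dsum_mx1. Qed.

Lemma dsum_fRM V W g h : dsum_mx (fR V (g * h)%g) (fR W (g * h)%g) =
  dsum_mx (fR V g) (fR W g) *m dsum_mx (fR V h) (fR W h).
Proof. by rewrite dsum_mxM !fRM. Qed.

Definition dsum V W := FRep (dsum_fR1 V W) (dsum_fRM V W).

Lemma ret_dsum V V' W W' : V <| V' -> W <| W' -> dsum V W <| dsum V' W'.
Proof.
move=> [i [r [hi hr ir]]] [i' [r' [hi' hr' ir']]].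
exists (dsum_mx i i'), (dsum_mx r r'); split=> [g|g|] /=; rewrite !dsum_mxM.
- by rewrite hi hi'.
- by rewrite hr hr'.
by rewrite ir ir' dsum_mx1.
Qed.

Lemma dsum_triv_option V (A : finType) :
  dsum V (tens V (triv A)) <| tens V (triv (option A)).
Proof.
pose f (x : fB (dsum V (tens V (triv A)))) : fB (tens V (triv (option A))) :=
  match x with inl v => (v, None) | inr p => (p.1, Some p.2) end.
apply: (ret_bij (f := f)).
  exists (fun p : fB (tens V (triv (option A))) =>
    if p.2 is Some a then inr (p.1, a) else inl p.1);
    by [case=> [?|[? ?]] | case=> ? [?|]].
by move=> g [v|[v a]] [w|[w b]];
  rewrite !ent_mxf /= ?ent_mxf /= ?ent1 ?mulr1 ?mulr0.
Qed.

End Fixed.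

(** Restriction when [f] is injective, inflation when it is surjective. *)
Definition pull (gT hT : finGroupType) (f : gT -> hT)
    (fM : {morph f : x y / (x * y)%g}) (V : frep hT) : frep gT.
Proof.
apply: (@FRep gT (fB V) (fun g => fR V (f g))) => [|g h]; last by rewrite fM fRM.
have f1 : f 1%g = 1%g by apply: (mulgI (f 1%g)); rewrite -fM !mulg1.
by rewrite f1 fR1.
Defined.

Section Pull.
Variables (gT hT : finGroupType) (f : gT -> hT).
Variable fM : {morph f : x y / (x * y)%g}.

Lemma ret_pull V W : V <| W -> pull fM V <| pull fM W.
Proof. by move=> [i [r [hi hr ir]]]; exists i, r; split=> [g|g|] /=. Qed.

Lemma tpow_pull V j : tpow (pull fM V) j <| pull fM (tpow V j).
Proof.
elim: j => [|j IHj]; first exact: ret_refl.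
apply: ret_trans (ret_tens (ret_refl _) IHj) _.
apply: (ret_bij (f := (id : fB (tens (pull fM V) (pull fM (tpow V j))) ->
  fB (pull fM (tens V (tpow V j)))))); first by exists id.
by move=> g a b; rewrite !ent_mxf.
Qed.

Lemma pull_tpow V j : pull fM (tpow V j) <| tpow (pull fM V) j.
Proof.
elim: j => [|j IHj]; first exact: ret_refl.
apply: ret_trans _ (ret_tens (ret_refl _) IHj).
apply: (ret_bij (f := (id : fB (pull fM (tens V (tpow V j))) ->
  fB (tens (pull fM V) (pull fM (tpow V j)))))); first by exists id.
by move=> g a b; rewrite !ent_mxf.
Qed.

End Pull.

End Representations.

Local Notation "V <| W" := (ret V W) (at level 70).

(** * Induction from a subgroup of invertible index *)

Section Blocks.
Variables (F : fieldType) (X : finType).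

(** Block monomial matrices, with block [M x] in position [(x, s x)]: the shape of the matrices of
    an induced module. *)
Definition blk (A B : finType) (M : X -> 'M[F]_(#|A|, #|B|)) (s : X -> X) :
    'M[F]_(#|{: X * A}|, #|{: X * B}|) :=
  mxf (fun x y => (s x.1 == y.1)%:R * ent (M x.1) x.2 y.2).

Lemma blkM (A B C : finType) (M : X -> 'M[F]_(#|A|, #|B|))
    (N : X -> 'M[F]_(#|B|, #|C|)) s t :
  blk M s *m blk N t = blk (fun x => M x *m N (s x)) (t \o s).
Proof.
apply: entP => -[x a] [z c]; rewrite ent_mul ent_mxf /= ent_mul.
transitivity (\sum_y \sum_b ent (blk M s) (x, a) (y, b) *
                             ent (blk N t) (y, b) (z, c)).
  by rewrite pair_big /=; apply: eq_bigr => -[].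
rewrite (bigD1 (s x)) //= [X in _ + X]big1 => [|y /negPf ne_y]; last first.
  by apply: big1 => b _; rewrite ent_mxf /= eq_sym ne_y !mul0r.
rewrite addr0 big_distrr; apply: eq_bigr => b _.
by rewrite !ent_mxf /= eqxx mul1r mulrCA.
Qed.

Lemma blk1 (A : finType) : blk (fun _ => 1%:M : 'M[F]_#|A|) id = 1%:M.
Proof.
apply: entP => -[x a] [y b]; rewrite ent_mxf !ent1 /= xpair_eqE.
by rewrite -natrM mulnb.
Qed.

Lemma eq_blk (A B : finType) (M N : X -> 'M[F]_(#|A|, #|B|)) s t :
  M =1 N -> s =1 t -> blk M s = blk N t.
Proof. by move=> eqM eqs; apply: entP => x y; rewrite !ent_mxf eqM eqs. Qed.

Lemma eq_tpw (A B : finType) (M N : X -> 'M[F]_(#|A|, #|B|)) s t :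
  M =1 N -> s =1 t -> tpw M s = tpw N t.
Proof.
move=> eqM eqs; apply: entP => x y; rewrite !ent_mxf.
by apply: eq_bigr => z _; rewrite eqM eqs.
Qed.

End Blocks.

Section Induction.

Variables (F : fieldType) (hT gT : finGroupType) (phi : hT -> gT).
Hypothesis phiM : {morph phi : x y / (x * y)%g}.
Hypothesis phi_inj : injective phi.

Let phi1 : phi 1%g = 1%g.
Proof. by apply: (mulgI (phi 1%g)); rewrite -phiM !mulg1. Qed.

Lemma image_group_set : group_set [set phi h | h in [set: hT]].
Proof.
apply/group_setP; split=> [|_ _ /imsetP[x _ ->] /imsetP[y _ ->]].
  by apply/imsetP; exists 1%g.
by apply/imsetP; exists (x * y)%g; rewrite ?phiM.
Qed.

Let H := Group image_group_set.
(** The chosen representative of the right coset of [x]. With [c x] below, the factor in [hT] such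
    that [phi (c x) * r x = x], it gives coordinates on [gT] as a product of [hT] and the set of
    cosets. *)
Let r (x : gT) : gT := repr (H :* x).

Let mem_phi h : phi h \in H.
Proof. by change (phi h \in [set phi h | h in [set: hT]]); apply/imsetP; exists h. Qed.

Let r_phi h x : r (phi h * x)%g = r x.
Proof. by rewrite /r rcosetM (@rcoset_id _ H (phi h)) ?mem_phi. Qed.

Let r_mem x : (x * (r x)^-1)%g \in H.
Proof. by rewrite -mem_rcoset rcoset_sym mem_repr_rcoset. Qed.

Let r_r x : r (r x) == r x.
Proof. by rewrite /r rcoset_repr. Qed.

Let cex x : exists h, (x * (r x)^-1 == phi h)%g.
Proof. by have /imsetP[h _ ->] := r_mem x; exists h. Qed.

Let c x := xchoose (cex x).

Let cE x : (phi (c x) * r x = x)%g.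
Proof. by rewrite -(eqP (xchooseP (cex x))) mulgKV. Qed.

Let c_phi h x : c (phi h * x)%g = (h * c x)%g.
Proof.
apply: phi_inj; apply: (mulIg (r x)); rewrite phiM -mulgA cE.
by rewrite -[X in (_ * X)%g](r_phi h x) cE.
Qed.

Let cosets : finType := {x | r x == x}.
Let rX x : cosets := exist _ (r x) (r_r x).

Let rX_val (x : cosets) : rX (val x) = x.
Proof. by apply: val_inj; apply/eqP; case: x. Qed.

Let c_val (x : cosets) : c (val x) = 1%g.
Proof.
apply: phi_inj; rewrite phi1; apply: (mulIg (r (val x))); rewrite cE mul1g.
by apply/esym/eqP; case: x.
Qed.

Let rXM x h : rX (r x * h)%g = rX (x * h)%g.
Proof. by apply: val_inj; rewrite /= -{2}(cE x) -mulgA r_phi. Qed.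

(** The cocycle identity that makes the matrices of the induced module multiplicative. *)
Let cM x h : c (x * h)%g = (c x * c (r x * h))%g.
Proof. by rewrite -{1}(cE x) -mulgA c_phi. Qed.

Section IndRep.
Variable T : frep F hT.

Let indR (g : gT) := blk (fun x : cosets => fR T (c (val x * g)%g))
                         (fun x => rX (val x * g)%g).

Lemma ind_fR1 : indR 1%g = 1%:M.
Proof.
rewrite -blk1; apply: eq_blk => x; rewrite mulg1 ?rX_val //.
by rewrite c_val fR1.
Qed.

Lemma ind_fRM g h : indR (g * h)%g = indR g *m indR h.
Proof.
rewrite blkM; apply: eq_blk => x /=; rewrite mulgA; last by rewrite rXM.
by rewrite (cM (_ * g)%g) fRM.
Qed.

Definition ind := FRep ind_fR1 ind_fRM.

End IndRep.

Lemma ret_ind T U : T <| U -> ind T <| ind U.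
Proof.
move=> [i [s [hi hs si]]]; exists (blk (fun _ => i) id), (blk (fun _ => s) id).
split=> [g|g|]; rewrite ?blkM.
- by apply: eq_blk => x //=; rewrite hi.
- by apply: eq_blk => x //=; rewrite hs.
by rewrite -blk1; apply: eq_blk => x //=; rewrite si.
Qed.

Lemma ind_triv T (A : finType) :
  ind (tens T (triv F hT A)) <| tens (ind T) (triv F gT A).
Proof.
apply: (ret_bij (f := fun x : fB (ind (tens T (triv F hT A))) =>
  ((x.1, x.2.1), x.2.2) : fB (tens (ind T) (triv F gT A)))).
  by exists (fun x : fB (tens (ind T) (triv F gT A)) => (x.1.1, (x.1.2, x.2)));
    [case=> [? [? ?]] | case=> [[? ?] ?]].
move=> g [x [t a]] [y [u b]]; rewrite ?ent_mxf /= ?ent_mxf /= ?ent_mxf /= !ent1.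
by rewrite mulrA.
Qed.

Lemma card_cosets : (#|cosets| * #|hT| = #|gT|)%N.
Proof.
rewrite mulnC -card_prod; apply: (bij_eq_card (f := fun y : hT * cosets =>
  (phi y.1 * val y.2)%g)).
exists (fun x => (c x, rX x)) => [[h x]|x] /=; last exact: cE.
by congr (_, _); [rewrite c_phi c_val mulg1 | apply: val_inj; rewrite /= r_phi;
  apply/eqP; case: x].
Qed.

(** The natural map [(x, m) -> m x] from the induced module to [V] is split by the averaged map
    [m -> 1/N sum_x (x, m x^-1)], where [N] is the number of cosets. The composite is a sum of [N]
    identities divided by [N], whence the hypothesis on the index. *)
Lemma ret_ind_pull (V : frep F gT) :
  (#|gT| %/ #|hT|)%N%:R != 0 :> F -> V <| ind (pull phiM V).
Proof.
have card_X : #|cosets| = (#|gT| %/ #|hT|)%N.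
  by rewrite -card_cosets mulnK //; apply/card_gt0P; exists 1%g.
rewrite -card_X => nzX.
pose i := mxf (fun (m : fB V) (y : fB (ind (pull phiM V))) =>
  #|cosets|%:R^-1 * ent (fR V (val y.1)^-1%g) m y.2).
pose s := mxf (fun (y : fB (ind (pull phiM V))) (m : fB V) =>
  ent (fR V (val y.1)) y.2 m).
have sumX (f : fB (ind (pull phiM V)) -> F) :
    \sum_y f y = \sum_(x : cosets) \sum_m f (x, m).
  by rewrite pair_big; apply: eq_bigr => -[].
exists i, s; split=> [g|g|]; apply: entP => a b; rewrite !ent_mul.
- case: b => x b; rewrite sumX (bigD1 (rX (val x * g^-1)%g)) //=.
  rewrite [X in _ + X]big1 ?addr0 => [|y]; last first.
    move=> ne_y; apply: big1 => m _; rewrite !ent_mxf /=.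
    case: eqP => [eq_x|]; last by rewrite mul0r mulr0.
    case/eqP: ne_y; rewrite -eq_x rXM mulgK; exact/esym/rX_val.
  transitivity (#|cosets|%:R^-1 * ent (fR V g *m fR V (val x)^-1%g) a b).
    rewrite ent_mul big_distrr; apply: eq_bigr => m _.
    by rewrite ent_mxf mulrCA.
  (* The only coset sent to [x] by [g] is that of [x g^-1]; the cocycle value there is [c y], and
     [phi (c y) * x = y] gives [g x^-1 = r (x g^-1)^-1 * phi (c y)]. *)
  pose y := (r (val x * g^-1) * g)%g.
  have ry : rX y = x by rewrite /y rXM mulgKV rX_val.
  have -> : fR V g *m fR V (val x)^-1%g =
      fR V (r (val x * g^-1)%g)^-1%g *m fR V (phi (c y)).
    rewrite -!fRM; congr (fR V _); apply: (mulIg (val x)).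
    rewrite mulgKV -mulgA -[in X in (_ * (_ * X))%g]ry cE /y.
    by rewrite mulgA mulVg mul1g.
  rewrite ent_mul big_distrr; apply: eq_bigr => m _.
  by rewrite !ent_mxf /= -/y ry eqxx mul1r mulrA.
- case: a => x a; rewrite sumX (bigD1 (rX (val x * g)%g)) //=.
  rewrite [X in _ + X]big1 ?addr0 => [|y /negPf ne_y]; last first.
    by apply: big1 => m _; rewrite !ent_mxf /= eq_sym ne_y !mul0r.
  transitivity (ent (fR V (phi (c (val x * g)%g)) *m fR V (r (val x * g)%g)) a b).
    rewrite ent_mul; apply: eq_bigr => m _.
    by rewrite !ent_mxf /= eqxx mul1r.
  rewrite -fRM cE fRM ent_mul.
  by apply: eq_bigr => m _; rewrite ent_mxf.
rewrite sumX ent1.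
under eq_bigr => x _.
  have -> : \sum_m ent i a (x, m) * ent s (x, m) b = #|cosets|%:R^-1 * (a == b)%:R.
    rewrite -ent1 -(fRK V (val x)) ent_mul big_distrr; apply: eq_bigr => m _.
    by rewrite !ent_mxf /= mulrA.
  over.
by rewrite sumr_const -[LHS]mulr_natl mulrA divff ?mul1r.
Qed.

(* A module is a direct summand of the induction of its restriction to a
   subgroup whose index is invertible. *)
Lemma algf_pull (V : frep F gT) :
  (#|gT| %/ #|hT|)%N%:R != 0 :> F -> algf (pull phiM V) -> algf V.
Proof.
move=> nz_index [T algT]; exists (ind T) => j; have [A TA] := algT j; exists A.
apply: ret_trans (ret_ind_pull _ nz_index) _.
apply: ret_trans (ret_ind (ret_trans (pull_tpow phiM V j) TA)) _.
exact: ind_triv.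
Qed.

End Induction.

(** * Wreath products *)

Section GroupAlgebra.

Variables (F : fieldType) (hT : finGroupType).

(** Elements of the group algebra are coefficient functions on [hT]: [delta] gives the basis, [conv]
    the product. Identities between them are only ever asserted after [act], that is, as operators
    on a module. *)
Definition delta (g h : hT) : F := (g == h)%:R.

Definition conv (f f' : hT -> F) (h : hT) : F :=
  \sum_g f g * f' (g^-1 * h)%g.

Definition act (V : frep F hT) (f : hT -> F) := \sum_h f h *: fR V h.

Lemma act_delta V g : act V (delta g) = fR V g.
Proof.
rewrite /act (bigD1 g) //= /delta eqxx scale1r big1 ?addr0 // => h.
by rewrite eq_sym => /negPf->; rewrite scale0r.
Qed.

Lemma act_conv V f f' : act V (conv f f') = act V f *m act V f'.
Proof.
rewrite /act mulmx_suml.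
under [RHS]eq_bigr => g _.
  rewrite (reindex_inj (mulgI g^-1%g)) mulmx_sumr; over.
under [LHS]eq_bigr => h _ do rewrite /conv scaler_suml.
rewrite exchange_big; apply: eq_bigr => g _; apply: eq_bigr => h _ /=.
by rewrite -scalemxAr -scalemxAl scalerA -fRM mulKVg mulrC.
Qed.

Lemma act_sum V (I : finType) (c : I -> F) (f : I -> hT -> F) :
  act V (fun h => \sum_i c i * f i h) = \sum_i c i *: act V (f i).
Proof.
rewrite /act; under eq_bigr => h _ do rewrite scaler_suml.
rewrite exchange_big; apply: eq_bigr => i _; rewrite scaler_sumr.
by apply: eq_bigr => h _; rewrite scalerA.
Qed.

Lemma actB V f f' : act V (fun h => f h - f' h) = act V f - act V f'.
Proof. by rewrite /act -sumrB; apply: eq_bigr => h _; rewrite scalerBl. Qed.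

(* [u] and [v] give maps [E (x) V -> V] and [V -> E (x) V], where the group
   acts trivially on the factor [V], built from elements of the group algebra;
   by the last clause they make [V] a direct summand of [E (x) V]. *)
Definition separates (E : frep F hT) (u v : fB E -> hT -> F) (V : frep F hT) :=
  [/\ forall a h, act V (conv (u a) (delta h)) =
                  \sum_b ent (fR E h) a b *: act V (u b),
      forall b h, act V (conv (delta h) (v b)) =
                  \sum_a ent (fR E h) a b *: act V (v a)
    & \sum_a act V (conv (v a) (u a)) = 1%:M].

End GroupAlgebra.

Lemma prod_scalemx (F : fieldType) n (I : Type) (s : seq I) (c : I -> F)
    (A : I -> 'M[F]_n) :
  \prod_(i <- s) (c i *: A i) = (\prod_(i <- s) c i) *: \prod_(i <- s) A i.
Proof.
elim: s => [|i s IHs]; first by rewrite !big_nil scale1r.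
rewrite !big_cons IHs; set B := \prod_(j <- s) A j; set d := \prod_(j <- s) c j.
change ((c i *: A i) *m (d *: B) = (c i * d) *: (A i *m B)).
by rewrite -scalemxAl -scalemxAr scalerA.
Qed.

Section Wreath.

Variables (hT kT : finGroupType) (X : finType).

(** The action is a phantom parameter: the underlying set ignores it, but the group structure
    attached to the type depends on it. *)
Definition wreath of {action kT &-> X} : Type := ({ffun X -> hT} * kT)%type.

Variable to : {action kT &-> X}.
Local Notation wr := (wreath to).

HB.instance Definition _ := Finite.on wr.

(** The law of the permutations [(x, y) -> (x k, h_x y)], composed from left to right. *)
Definition wr_mul (g g' : wr) : wr :=
  ([ffun x => g.1 x * g'.1 (to x g.2)], g.2 * g'.2)%g.

Definition wr_one : wr := ([ffun=> 1], 1)%g.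

Definition wr_inv (g : wr) : wr :=
  ([ffun x => (g.1 (to x g.2^-1))^-1], g.2^-1)%g.

Lemma wr_mulA : associative wr_mul.
Proof.
move=> [h k] [h' k'] [h'' k'']; congr (_, _); last exact: mulgA.
by apply/ffunP=> x; rewrite !ffunE /= actM mulgA.
Qed.

Lemma wr_mul1 : left_id wr_one wr_mul.
Proof.
move=> [h k]; congr (_, _); last exact: mul1g.
by apply/ffunP=> x; rewrite !ffunE /= act1 mul1g.
Qed.

Lemma wr_mulV : left_inverse wr_one wr_inv wr_mul.
Proof.
move=> [h k]; congr (_, _); last exact: mulVg.
by apply/ffunP=> x; rewrite !ffunE /= mulVg.
Qed.

HB.instance Definition _ := Finite_isGroup.Build wr wr_mulA wr_mul1 wr_mulV.

Definition wbase (h : {ffun X -> hT}) : wr := (h, 1%g).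
Definition wtop (k : kT) : wr := ([ffun=> 1%g], k).
Definition wcoord (x : X) (h : hT) : wr :=
  wbase [ffun y => if y == x then h else 1%g].
Definition wproj (g : wr) : kT := g.2.

Lemma wr_mulE (g g' : wr) : (g * g')%g = wr_mul g g'.
Proof. by []. Qed.

Lemma wbaseM (h h' : {ffun X -> hT}) :
  wbase [ffun x => h x * h' x]%g = (wbase h * wbase h')%g.
Proof.
rewrite wr_mulE; congr (_, _); last by rewrite /= mulg1.
by apply/ffunP=> x; rewrite !ffunE /= act1.
Qed.

Lemma wtopM : {morph wtop : k k' / (k * k')%g}.
Proof.
move=> k k'; rewrite wr_mulE; congr (_, _).
by apply/ffunP=> x; rewrite !ffunE mulg1.
Qed.

Lemma wprojM : {morph wproj : g g' / (g * g')%g}. Proof. by []. Qed.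

Lemma wcoordM x : {morph wcoord x : h h' / (h * h')%g}.
Proof.
move=> h h'; rewrite /wcoord -wbaseM; congr wbase; apply/ffunP=> y.
by rewrite !ffunE; case: eqP => //; rewrite mulg1.
Qed.

Lemma wbase_wtop g : g = (wbase g.1 * wtop g.2)%g.
Proof.
case: g => h k; rewrite wr_mulE; congr (_, _); last by rewrite /= mul1g.
by apply/ffunP=> x; rewrite !ffunE mulg1.
Qed.

Lemma wtop_wbase k (h : {ffun X -> hT}) :
  (wtop k * wbase h = wbase [ffun x => h (to x k)] * wtop k)%g.
Proof.
rewrite !wr_mulE; congr (_, _); last by rewrite /= mul1g mulg1.
by apply/ffunP=> x; rewrite !ffunE mulg1 mul1g.
Qed.

Lemma wbase_prod (h : {ffun X -> hT}) : wbase h = (\prod_(x : X) wcoord x (h x))%g.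
Proof.
suffices prodE s : uniq s -> (\prod_(x <- s) wcoord x (h x))%g =
    wbase [ffun y => if y \in s then h y else 1%g].
  rewrite prodE ?index_enum_uniq //; congr wbase; apply/ffunP=> y.
  by rewrite ffunE mem_index_enum.
elim: s => [|x s IHs] /=; first by rewrite big_nil.
case/andP=> s'x /IHs{}IHs; rewrite big_cons IHs -wbaseM; congr wbase.
apply/ffunP=> y; rewrite !ffunE in_cons; case: eqP => [->|_] /=.
  by rewrite (negPf s'x) mulg1.
by rewrite mul1g.
Qed.

Variable F : fieldType.

(** * Tensor induction to a wreath product *)

Section TensorInduction.
Variable E : frep F hT.

Let tindR (g : wr) := tpw (fun x : X => fR E (g.1 x)) (fun x => to x g.2).

Lemma tind_fR1 : tindR 1%g = 1%:M.
Proof.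
by rewrite -tpw1; apply: eq_tpw => x; rewrite /= ?act1 // ffunE fR1.
Qed.

Lemma tind_fRM g g' : tindR (g * g')%g = tindR g *m tindR g'.
Proof.
rewrite tpwM; last by exists (fun x => to x g.2^-1%g); [exact: actK | exact: actKV].
by apply: eq_tpw => x /=; rewrite ?actM // ffunE fRM.
Qed.

Definition tind := FRep tind_fR1 tind_fRM.

End TensorInduction.

Lemma ret_tind E E' : E <| E' -> tind E <| tind E'.
Proof.
move=> [i [r [hi hr ir]]].
exists (tpw (fun _ : X => i) id), (tpw (fun _ : X => r) id).
have bij_id : bijective (@id X) by exists id.
have bij_to (k : kT) : bijective (fun x : X => to x k).
  by exists (fun x => to x k^-1%g); [exact: actK | exact: actKV].
split=> [g|g|]; rewrite ?tpwM //.
- by apply: eq_tpw => x //=; rewrite hi.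
- by apply: eq_tpw => x //=; rewrite hr.
by rewrite -tpw1; apply: eq_tpw => x //=; rewrite ir.
Qed.

Lemma tind_tens E E' : tind (tens E E') <| tens (tind E) (tind E').
Proof.
apply: (ret_bij (f := fun y : fB (tind (tens E E')) =>
  ([ffun x => (y x).1], [ffun x => (y x).2]) : fB (tens (tind E) (tind E')))).
  exists (fun y : fB (tens (tind E) (tind E')) =>
      [ffun x => (y.1 x, y.2 x)] : fB (tind (tens E E'))).
    by move=> y; apply/ffunP=> x; rewrite !ffunE /=; case: (y x).
  by case=> y y'; congr (_, _); apply/ffunP=> x; rewrite !ffunE.
move=> g y z; rewrite !ent_mxf /= ?ent_mxf -big_split /=.
by apply: eq_bigr => x _; rewrite ent_mxf !ffunE.
Qed.

(** The permutation module of [kT] on the functions [X -> A]. *)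
Definition perm_rep (A : finType) := pull wtopM (tind (triv F hT A)).

Lemma tind_triv A : tind (triv F hT A) <| pull wprojM (perm_rep A).
Proof.
apply: (ret_bij (f := (id : fB (tind (triv F hT A)) ->
  fB (pull wprojM (perm_rep A))))); first by exists id.
by move=> g y z; rewrite !ent_mxf.
Qed.

Lemma tpow_tind E j : tpow (tind E) j <| tind (tpow E j).
Proof.
elim: j => [|j IHj] /=.
  have triv_bij : bijective (fun _ : unit => [ffun=> tt] : {ffun X -> unit}).
    by exists (fun=> tt) => [[]|y] //; apply/ffunP=> x; case: (_ x); case: (y x).
  apply: (ret_bij (f := (fun _ => [ffun=> tt]) :
    fB (triv F wr unit) -> fB (tind (triv F hT unit)))) => // g [] [].
  by rewrite ent_mxf !ent1 eqxx big1 // => x _; rewrite ent1 !ffunE eqxx.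
apply: ret_trans (ret_tens (ret_refl _) IHj) _.
apply: (ret_bij (f := fun y : fB (tens (tind E) (tind (tpow E j))) =>
  [ffun x => (y.1 x, y.2 x)] : fB (tind (tens E (tpow E j))))).
  exists (fun y : fB (tind (tens E (tpow E j))) =>
    ([ffun x => (y x).1], [ffun x => (y x).2]) : fB (tens (tind E) (tind (tpow E j)))).
    by case=> y y'; congr (_, _); apply/ffunP=> x; rewrite !ffunE.
  by move=> y; apply/ffunP=> x; rewrite !ffunE /=; case: (y x).
move=> g y z; rewrite !ent_mxf /= ?ent_mxf -big_split /=.
by apply: eq_bigr => x _; rewrite ent_mxf !ffunE.
Qed.

(** Tensor induction turns the multiplicity space [triv A] of a power of [E] into the permutation
    module [perm_rep A], on which the top group may act nontrivially. This module cannot be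
    discarded as a multiplicity, so the hypothesis bounds it jointly with the powers of [W]. *)
Lemma algf_tind (E : frep F hT) (W TW : frep F kT) :
    algf E ->
    (forall A j, exists B : finType,
       tens (perm_rep A) (tpow W j) <| tens TW (triv F kT B)) ->
  algf (tens (tind E) (pull wprojM W)).
Proof.
move=> [T algT] algW; exists (tens (tind T) (pull wprojM TW)) => j.
have [A TA] := algT j; have [B TB] := algW A j; exists B.
apply: ret_trans (tpow_tens _ _ _) _.
have tindA : tpow (tind E) j <| tens (tind T) (pull wprojM (perm_rep A)).
  apply: ret_trans (tpow_tind _ _) _; apply: ret_trans (ret_tind TA) _.
  apply: ret_trans (tind_tens _ _) _.
  by apply: ret_tens (tind_triv _); apply: ret_refl.
apply: ret_trans (ret_tens tindA (tpow_pull _ _ _)) _.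
apply: ret_trans (ret_tensA _ _ _) _.
have pullB : tens (pull wprojM (perm_rep A)) (pull wprojM (tpow W j)) <|
    tens (pull wprojM TW) (triv F _ B).
  have pull_tens (U V : frep F kT) :
      tens (pull wprojM U) (pull wprojM V) <| pull wprojM (tens U V).
    apply: (ret_bij (f := (id : fB (tens (pull wprojM U) (pull wprojM V)) ->
      fB (pull wprojM (tens U V))))); first by exists id.
    by move=> g y z; rewrite !ent_mxf.
  apply: ret_trans (pull_tens _ _) _.
  apply: ret_trans (ret_pull wprojM TB) _.
  apply: (ret_bij (f := (id : fB (pull wprojM (tens TW (triv F kT B))) ->
    fB (tens (pull wprojM TW) (triv F _ B))))); first by exists id.
  by move=> g y z; rewrite !ent_mxf.
apply: ret_trans (ret_tens (ret_refl _) pullB) _.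
apply: (ret_bij (f := fun y : fB (tens (tind T) (tens (pull wprojM TW) (triv F _ B))) =>
  ((y.1, y.2.1), y.2.2) : fB (tens (tens (tind T) (pull wprojM TW)) (triv F _ B)))).
  by exists (fun y : fB (tens (tens (tind T) (pull wprojM TW)) (triv F _ B)) =>
    (y.1.1, (y.1.2, y.2))); [case=> [? [? ?]] | case=> [[? ?] ?]].
by move=> g [y [t b]] [z [t' b']]; rewrite ?ent_mxf /= ?ent_mxf /= ?ent_mxf mulrA.
Qed.

(** * The group algebra of the base acting on a module of the wreath product *)

Section BaseAlgebra.
Variable M : frep F wr.

(** The action of the pure tensor of the [f x], the group algebra of the base being the tensor power
    over [X] of that of [hT]. *)
Definition bact (f : X -> hT -> F) :=
  \sum_(h : {ffun X -> hT}) (\prod_x f x (h x)) *: fR M (wbase h).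

Lemma bact_prod f :
  bact f = \prod_(x : X) (act (pull (wcoordM x) M) (f x) : 'M[F]_#|fB M|).
Proof.
rewrite /act (bigA_distr_bigA (fun x h => f x h *: fR M (wcoord x h))).
apply: eq_bigr => h _.
have -> : fR M (wbase h) = \prod_(x : X) (fR M (wcoord x (h x)) : 'M[F]_#|fB M|).
  rewrite wbase_prod (big_morph (fR M) (fRM M) (fR1 M)); exact: eq_bigr.
by rewrite prod_scalemx.
Qed.

(** By [bact_prod] a pure tensor acts through the actions of its factors on the coordinate copies of
    [hT]. The relations in [separates], which hold only as operators, may thus be applied one
    coordinate at a time. *)
Lemma bact_ext f f' :
  (forall x, act (pull (wcoordM x) M) (f x) = act (pull (wcoordM x) M) (f' x)) ->
  bact f = bact f'.
Proof. by move=> eqf; rewrite !bact_prod; apply: eq_bigr => x _; exact: eqf. Qed.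

Lemma bact_delta h : fR M (wbase h) = bact (fun x => delta F (h x)).
Proof.
rewrite /bact (bigD1 h) //= [\prod_x _]big1 => [|x _]; last by rewrite /delta eqxx.
rewrite scale1r big1 ?addr0 // => h' /eqP ne_h.
have [x ne_x] : exists x, h x != h' x.
  apply/existsP; rewrite -negb_forall; apply/negP=> /forallP eq_h.
  by apply: ne_h; apply/ffunP=> x; rewrite (eqP (eq_h x)).
by rewrite (bigD1 x) //= /delta (negPf ne_x) mul0r scale0r.
Qed.

Lemma bact_conv f f' : bact (fun x => conv (f x) (f' x)) = bact f *m bact f'.
Proof.
rewrite /bact mulmx_suml.
under eq_bigr => h _.
  rewrite /conv (bigA_distr_bigA (fun x g => f x g * f' x (g^-1 * h x)%g)).
  rewrite scaler_suml; over.
rewrite exchange_big; apply: eq_bigr => g _ /=; rewrite mulmx_sumr.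
rewrite (reindex (fun h : {ffun X -> hT} => [ffun x => g x * h x]%g)) /=; last first.
  exists (fun h : {ffun X -> hT} => [ffun x => (g x)^-1 * h x]%g) => h _;
    by apply/ffunP=> x; rewrite !ffunE ?mulKg ?mulKVg.
apply: eq_bigr => h _; rewrite -scalemxAr -scalemxAl scalerA wbaseM fRM big_split.
rewrite /= mulrC; congr (_ * _ *: _).
by apply: eq_bigr => x _; rewrite ffunE mulKg.
Qed.

Lemma bact_sum (I : finType) (c : X -> I -> F) (f : X -> I -> hT -> F) :
  bact (fun x h => \sum_i c x i * f x i h) =
  \sum_(b : {ffun X -> I}) (\prod_x c x (b x)) *: bact (fun x => f x (b x)).
Proof.
rewrite /bact; under eq_bigr => h _.
  rewrite (bigA_distr_bigA (fun x i => c x i * f x i (h x))) scaler_suml; over.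
rewrite exchange_big; apply: eq_bigr => b _; rewrite scaler_sumr.
by apply: eq_bigr => h _; rewrite scalerA big_split.
Qed.

Lemma wtop_bact k f :
  fR M (wtop k) *m bact f = bact (fun x => f (to x k)) *m fR M (wtop k).
Proof.
rewrite /bact mulmx_sumr mulmx_suml.
rewrite [RHS](reindex (fun h : {ffun X -> hT} => [ffun x => h (to x k)])) /=.
  apply: eq_bigr => h _; rewrite -scalemxAr -scalemxAl -!fRM wtop_wbase.
  congr (_ *: _); rewrite (reindex (fun x => to x k)) /=.
    by apply: eq_bigr => x _; rewrite ffunE.
  by exists (fun x => to x k^-1%g) => x _; [exact: actK | exact: actKV].
exists (fun h : {ffun X -> hT} => [ffun x => h (to x k^-1%g)]) => h _;
  by apply/ffunP=> x; rewrite !ffunE ?actK ?actKV.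
Qed.

(** The maps are [m -> sum_b (b, m V_b)] and [(b, m) -> m U_b]. In [U_b g] with [g = h k], the base
    part [h] is absorbed into the matrix of [E^(X)] by [separates], and [k] passes to the left while
    permuting the factors. Only [k] is left to act on the copy of [M], which is why the second
    factor is inflated from the top group. *)
Lemma ret_tind_top (E : frep F hT) (u v : fB E -> hT -> F) :
    (forall x, separates u v (pull (wcoordM x) M)) ->
  M <| tens (tind E) (pull wprojM (pull wtopM M)).
Proof.
move=> sep_uv.
pose U (b : fB (tind E)) := bact (fun x => u (b x)).
pose V (b : fB (tind E)) := bact (fun x => v (b x)).
have mulU b g : U b *m fR M g =
    \sum_c ent (fR (tind E) g) b c *: (fR M (wtop g.2) *m U c).
  rewrite {1}(wbase_wtop g) fRM mulmxA bact_delta -bact_conv.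
  rewrite (bact_ext (f' := fun x h =>
      \sum_a ent (fR E (g.1 x)) (b x) a * u a h)); last first.
    by move=> x; rewrite act_sum; case: (sep_uv x).
  rewrite bact_sum mulmx_suml.
  (* Moving [wtop g.2] across the product permutes its factors; the substitution in [c] undoes this
     permutation. *)
  rewrite [RHS](reindex (fun c : {ffun X -> fB E} => [ffun x => c (to x g.2^-1%g)])) /=.
    apply: eq_bigr => c _; rewrite wtop_bact -scalemxAl ent_mxf.
    rewrite [in RHS](bact_ext (f' := fun x => u (c x))) => [|x]; last first.
      by rewrite ffunE actK.
    by congr (_ *: _); apply: eq_bigr => x _; rewrite ffunE actK.
  exists (fun c : {ffun X -> fB E} => [ffun x => c (to x g.2)]) => c _;
    by apply/ffunP=> x; rewrite !ffunE ?actK ?actKV.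
have mulV b g : fR M g *m V b =
    \sum_c ent (fR (tind E) g) c b *: (V c *m fR M (wtop g.2)).
  rewrite {1}(wbase_wtop g) fRM -mulmxA wtop_bact mulmxA bact_delta -bact_conv.
  rewrite (bact_ext (f' := fun x h =>
      \sum_a ent (fR E (g.1 x)) a (b (to x g.2)) * v a h)); last first.
    by move=> x; rewrite act_sum; case: (sep_uv x).
  rewrite bact_sum mulmx_suml; apply: eq_bigr => c _.
  by rewrite -scalemxAl ent_mxf.
have mulVU : \sum_b V b *m U b = 1%:M.
  under eq_bigr => b _ do rewrite -bact_conv -[bact _]scale1r.
  transitivity (bact (fun x h => \sum_a 1 * conv (v a) (u a) h)).
    rewrite (bact_sum (fun _ _ => 1) (fun _ a => conv (v a) (u a))).
    by apply: eq_bigr => b _; rewrite big1.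
  rewrite -(fR1 M) -[1%g]/(wbase [ffun=> 1%g]) bact_delta; apply: bact_ext => x.
  rewrite act_sum act_delta ffunE fR1; case: (sep_uv x) => _ _ <-.
  by apply: eq_bigr => a _; rewrite scale1r.
pose W := tens (tind E) (pull wprojM (pull wtopM M)).
pose i := mxf (fun (m : fB M) (y : fB W) => ent (V y.1) m y.2).
pose r := mxf (fun (y : fB W) (m : fB M) => ent (U y.1) y.2 m).
have sumW (f : fB W -> F) : \sum_y f y = \sum_b \sum_m f (b, m).
  by rewrite pair_big; apply: eq_bigr => -[].
exists i, r; split=> [g|g|]; apply: entP => a b; rewrite !ent_mul.
- transitivity (ent (fR M g *m V b.1) a b.2).
    by rewrite ent_mul; apply: eq_bigr => m _; rewrite ent_mxf.
  rewrite mulV ent_sum sumW; apply: eq_bigr => c _.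
  rewrite entZ ent_mul big_distrr; apply: eq_bigr => m _.
  by rewrite !ent_mxf /= mulrCA.
- transitivity (ent (U a.1 *m fR M g) a.2 b).
    rewrite mulU ent_sum sumW; apply: eq_bigr => c _.
    rewrite entZ ent_mul big_distrr; apply: eq_bigr => m _.
    by rewrite !ent_mxf /= mulrA.
  by rewrite ent_mul; apply: eq_bigr => m _; rewrite ent_mxf.
rewrite sumW -mulVU ent_sum; apply: eq_bigr => c _.
by rewrite ent_mul; apply: eq_bigr => m _; rewrite !ent_mxf.
Qed.

End BaseAlgebra.

End Wreath.

(** * Krull-Schmidt *)

Section KrullSchmidt.

Variables (F : fieldType) (gT : finGroupType).
Local Notation rep := (representation F [set: gT]).
Implicit Types M N T : rep.

Definition intertwines M N (f : 'M[F]_(rdegree M, rdegree N)) :=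
  forall g, M g *m f = f *m N g.

Definition mret M N : Prop :=
  exists (i : 'M_(rdegree M, rdegree N)) (r : 'M_(rdegree N, rdegree M)),
  [/\ intertwines i, intertwines r & i *m r = 1%:M].

Lemma intertwinesM M N T (f : 'M_(rdegree M, rdegree N))
    (f' : 'M_(rdegree N, rdegree T)) :
  intertwines f -> intertwines f' -> intertwines (f *m f').
Proof.
by move=> hf hf' g; rewrite mulmxA hf -[LHS]mulmxA hf' mulmxA.
Qed.

Lemma mret_trans M N T : mret M N -> mret N T -> mret M T.
Proof.
move=> [i [r [hi hr ir]]] [i' [r' [hi' hr' ir']]].
exists (i *m i'), (r' *m r); split; try exact: intertwinesM.
by rewrite mulmxA -[_ *m r']mulmxA ir' mulmx1.
Qed.

Lemma mret_rsim M N : mx_rsim M N -> mret M N.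
Proof.
case: M N => m M [n N] /= [B def_m]; case: n / def_m N B => N B.
rewrite row_free_unit => uB homB; exists B, (invmx B); split=> [g|g|] /=.
- exact/homB/in_setT.
- by rewrite -[N g](mulKmx uB) -homB ?in_setT // mulmxA mulmxK.
exact: mulmxV.
Qed.

Lemma mret_daddl M N : mret M (dadd_grepr M N).
Proof.
exists (row_mx 1%:M 0), (col_mx 1%:M 0); split=> [g|g|] /=.
- by rewrite mul_mx_row mul_row_block !mulmx0 !mul1mx mulmx1 mul0mx !addr0.
- by rewrite mul_block_col mul_col_mx !mulmx1 !mul0mx !mul1mx mulmx0 !addr0.
by rewrite mul_row_col mulmx1 mul0mx addr0.
Qed.

Lemma idempotent_splits M (e : 'M_(rdegree M)) :
    intertwines e -> e *m e = e ->
  exists N1 N2 : rep,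
    [/\ mx_rsim M (dadd_grepr N1 N2), rdegree N1 = \rank e
      & rdegree N2 = \rank (1%:M - e)].
Proof.
move=> he ee; set e' := 1%:M - e.
have mod_e : mxmodule M e.
  by apply/mxmoduleP=> g _; rewrite -he submxMl.
have mod_e' : mxmodule M e'.
  apply/mxmoduleP=> g _; rewrite mulmxBl mul1mx -he.
  by rewrite -[X in X - _]mulmx1 -mulmxBr submxMl.
have sum1 : (e + e' :=: 1%:M)%MS.
  apply/eqmxP; rewrite submx1 /=; apply/sub_addsmxP; exists (1%:M, 1%:M).
  by rewrite /= !mul1mx addrC subrK.
have direct : mxdirect (e + e').
  apply/mxdirect_addsP/eqP; rewrite -submx0; apply/row_subP=> i.
  have := row_sub i (e :&: e')%MS; rewrite sub_capmx.
  case/andP=> /submxP[w ->] /submxP[w' eq_w].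
  rewrite -[w *m e]mulmx1 -{1}ee mulmxA eq_w -!mulmxA mulmx1.
  by rewrite mulmxBl mul1mx ee subrr mulmx0 sub0mx.
exists (Representation (submod_repr mod_e)), (Representation (submod_repr mod_e')).
split=> //; apply: mx_rsim_trans (mx_rsim_sym (rsim_submod1 (mxmodule1 M) _)) _ => //.
by apply: mx_rsim_dadd sum1 direct _ _; apply: mx_rsim_refl.
Qed.

Lemma indecomposable_idem M (e : 'M_(rdegree M)) :
  indecomposable M -> intertwines e -> e *m e = e -> e = 0 \/ e = 1%:M.
Proof.
move=> [_ indM] he ee; have [N1 [N2 [simM d1 d2]]] := idempotent_splits he ee.
have [d0|d0] := indM _ _ simM; [left|right].
  by apply/eqP; rewrite -mxrank_eq0 -d1 d0.
by apply/esym/eqP; rewrite -subr_eq0 -mxrank_eq0 -d2 d0.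
Qed.

(* If [q X^m] is the minimal polynomial of [f] with [q] prime to [X], Bezout
   gives a polynomial in [f] which is idempotent, hence 0 or 1. *)
Lemma fitting M (f : 'M_(rdegree M)) :
  indecomposable M -> intertwines f ->
  f \in unitmx \/ 1%:M - f \in unitmx.
Proof.
case: M f => -[|n] rM f indM hf; first by case: indM.
have [m [q q0 defp]] := multiplicity_XsubC (mxminpoly f) 0.
rewrite monic_neq0 ?mxminpoly_monic // subr0 /= in q0 defp.
(* The exponent is positive even if [X] does not divide the minimal polynomial, so that [e = 1]
   exhibits the inverse [v(f) f^m] of [f]. If [e = 0], then [f^(m+1) = 0] and the geometric sum
   inverts [1 - f]. *)
have : coprimep q ('X ^+ m.+1) by rewrite coprimep_expr // coprimepX.
case/Bezout_eq1_coprimepP=> -[u v] /= uv1.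
pose P := horner_mx f; pose e := P (v * 'X^(m.+1)).
have PqX p : P (p * (q * 'X^(m.+1))) = 0.
  rewrite /P exprSr (mulrA q) -defp !rmorphM /= mx_root_minpoly.
  by rewrite mul0r mulr0.
have e1 : P (u * q) = 1 - e.
  by apply/eqP; rewrite eq_sym subr_eq /e /P -rmorphD /= uv1 rmorph1.
have ee : e * e = e.
  apply/eqP; rewrite eq_sym -subr_eq0 -{1}[e]mulr1 -mulrBr -e1 /e /P -rmorphM /= -/P.
  by rewrite mulrACA [_ * q]mulrC PqX.
have hP p : @intertwines (Representation rM) (Representation rM) (P p).
  by move=> g; apply: comm_mx_horner; apply: hf.
have PX : P 'X = f by rewrite /P horner_mx_X.
case: (indecomposable_idem indM (hP _) ee) => [e0|e1'].
  right; have fm0 : f ^+ m.+1 = 0.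
    rewrite -PX /P -rmorphXn /= -['X^_]mulr1 -uv1 mulrDr rmorphD /=.
    rewrite mulrCA [_ * q]mulrC -/P PqX add0r /P rmorphM /= -/P.
    by rewrite e0 mulr0.
  apply: (proj1 (mulmx1_unit (B := \sum_(i < m.+1) f ^+ i) _)).
  have := subrX1 f m.+1; rewrite fm0 sub0r => /(congr1 -%R).
  by rewrite opprK -mulNr opprB => /esym.
left; apply: (proj2 (mulmx1_unit (A := P (v * 'X^m)) _)).
by rewrite -[X in _ *m X]PX -[LHS](rmorphM P) -mulrA -exprSr.
Qed.

Lemma intertwines_invmx M (f : 'M_(rdegree M)) :
  f \in unitmx -> intertwines f -> intertwines (invmx f).
Proof.
move=> uf hf g; rewrite -[LHS](mulKmx uf); congr (_ *m _).
by rewrite mulmxA -hf mulmxK.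
Qed.

(** Locality of the endomorphism ring, applied to [f t^-1] with [t] the whole sum: if this is not
    invertible then [1 - f t^-1] is, and hence so is the sum of the remaining terms. *)
Lemma unit_summand M (s : seq 'M_(rdegree M)) :
    indecomposable M -> (forall f, f \in s -> intertwines f) ->
  \sum_(f <- s) f \in unitmx -> exists2 f, f \in s & f \in unitmx.
Proof.
move=> indM; elim: s => [|f s IHs] hs.
  case: M indM hs => -[|n] rM indM hs; first by case: indM.
  by rewrite big_nil unitmxE det0 unitr0.
rewrite big_cons => us; set t := f + _ in us.
have hf : intertwines f by apply: hs; rewrite mem_head.
have hs' : forall f', f' \in s -> intertwines f'.
  by move=> f' sf'; apply: hs; rewrite inE sf' orbT.
have ht : intertwines t.
  move=> g; rewrite mulmxDr mulmxDl hf mulmx_sumr mulmx_suml; congr (_ + _).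
  by apply: eq_big_seq => f' sf'; apply: hs'.
have := fitting indM (intertwinesM hf (intertwines_invmx us ht)).
rewrite unitmx_mul => -[/andP[uf _]|u1]; first by exists f; rewrite ?mem_head.
have [|f' sf' uf'] := IHs hs'; last by exists f'; rewrite // inE sf' orbT.
have -> : \sum_(f' <- s) f' = (1%:M - f *m invmx t) *m t.
  by rewrite mulmxBl mul1mx mulmxKV // /t addrC addKr.
by rewrite unitmx_mul u1.
Qed.

(** Some [i t *m r t] is invertible by locality, and its inverse corrects [r t] to a retraction.
    Working with a decomposition of the identity covers both direct sums and multiplicities. *)
Lemma mret_sum N (I : finType) (T : I -> rep)
    (i : forall t, 'M_(rdegree N, rdegree (T t)))
    (r : forall t, 'M_(rdegree (T t), rdegree N)) :
    indecomposable N ->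
    (forall t, intertwines (i t)) -> (forall t, intertwines (r t)) ->
  \sum_t i t *m r t = 1%:M -> exists t, mret N (T t).
Proof.
move=> indN hi hr ir1.
have [||f /mapP[t _ ->] uf] := @unit_summand N [seq i t *m r t | t <- enum I] indN.
- by move=> f /mapP[t _ ->]; apply: intertwinesM.
- by rewrite big_map -big_enum /= in ir1 *; rewrite ir1 unitmx1.
exists t, (i t), (r t *m invmx (i t *m r t)); split=> //.
  by apply: intertwinesM => //; apply: intertwines_invmx => //; apply: intertwinesM.
by rewrite mulmxA mulmxV.
Qed.

Lemma mret_dadd N T1 T2 :
  indecomposable N -> mret N (dadd_grepr T1 T2) -> mret N T1 \/ mret N T2.
Proof.
move=> indN [i [r [hi hr ir]]].
pose T b := if b then T1 else T2.
pose ii : forall b, 'M_(rdegree N, rdegree (T b)) :=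
  fun b => if b return 'M_(rdegree N, rdegree (T b)) then lsubmx i else rsubmx i.
pose rr : forall b, 'M_(rdegree (T b), rdegree N) :=
  fun b => if b return 'M_(rdegree (T b), rdegree N) then usubmx r else dsubmx r.
have [|||[] Nb] := @mret_sum N bool T ii rr indN; last by right.
- have hi' b g : N g *m ii b = ii b *m T b g.
    have := hi g; rewrite -{1 2}[i]hsubmxK mul_mx_row mul_row_block.
    by rewrite !mulmx0 addr0 add0r => /eq_row_mx[]; case: b.
  by move=> b g; apply: hi'.
- have hr' b g : T b g *m rr b = rr b *m N g.
    have := hr g; rewrite /= -{1 2}[r]vsubmxK mul_block_col mul_col_mx.
    by rewrite !mul0mx addr0 add0r => /eq_col_mx[]; case: b.
  by move=> b g; apply: hr'.
- by rewrite big_bool /= -mul_row_col hsubmxK vsubmxK.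
by left.
Qed.

Lemma mret_indecomposable N T :
  indecomposable N -> indecomposable T -> mret N T -> mx_rsim N T.
Proof.
move=> [N_gt0 _] indT [i [r [hi hr ir]]].
have := indecomposable_idem indT (intertwinesM hr hi).
rewrite mulmxA -[_ *m i *m r]mulmxA ir mulmx1 => /(_ erefl)[ri|ri].
  have /eqP : i *m r *m (i *m r) = 0.
    by rewrite mulmxA -[_ *m r *m i]mulmxA ri mulmx0 mul0mx.
  by rewrite ir mulmx1 -mxrank_eq0 mxrank1 eqn0Ngt N_gt0.
have eq_deg : rdegree N = rdegree T.
  apply/eqP; rewrite eqn_leq; apply/andP; split.
    by rewrite -(mxrank1 F (rdegree N)) -ir (leq_trans (mxrankM_maxr _ _))
      ?rank_leq_row.
  by rewrite -(mxrank1 F (rdegree T)) -ri (leq_trans (mxrankM_maxr _ _))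
      ?rank_leq_row.
exists i => //.
by apply/row_freeP; exists r.
Qed.

(** Induction on the degree: an indecomposable summand of [N1 + N2] is already a summand of [N1] or
    of [N2]. *)
Lemma finite_indecomposables T : exists s : seq rep,
  forall N, indecomposable N -> mret N T ->
    exists2 i, (i < size s)%N & mx_rsim N (nth T s i).
Proof.
have [n] := ubnP (rdegree T); elim: n T => // n IHn T /ltnSE le_n.
have [indT|not_indT] := classic (indecomposable T).
  by exists [:: T] => N indN NT; exists 0 => //; apply: mret_indecomposable.
have [T0|T_gt0] := posnP (rdegree T).
  exists [::] => N [N_gt0 _] [i [r [_ _ ir]]].
  have := leq_trans (mxrankM_maxl i r) (rank_leq_col i).
  by rewrite ir mxrank1 leqNgt T0 N_gt0.
have [N1 [N2 [simT d1 d2]]] : exists N1 N2 : rep,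
    [/\ mx_rsim T (dadd_grepr N1 N2), 0 < rdegree N1 & 0 < rdegree N2]%N.
  apply: NNPP => noN; apply: not_indT; split=> // N1 N2 simT.
  case: (posnP (rdegree N1)) => [|d1]; first by left.
  case: (posnP (rdegree N2)) => [|d2]; first by right.
  by case: noN; exists N1, N2.
have degT : rdegree T = (rdegree N1 + rdegree N2)%N := mxrank_rsim simT.
have [|s1 hs1] := IHn N1.
  by rewrite (leq_trans _ le_n) // degT -addn1 leq_add2l.
have [|s2 hs2] := IHn N2.
  by rewrite (leq_trans _ le_n) // degT -add1n leq_add2r.
exists (s1 ++ s2) => N indN NT.
have [NT1|NT2] := mret_dadd indN (mret_trans NT (mret_rsim simT)).
  have [i i_lt simN] := hs1 N indN NT1; exists i.
    by rewrite size_cat ltn_addr.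
  by rewrite nth_cat i_lt (set_nth_default N1).
have [i i_lt simN] := hs2 N indN NT2; exists (size s1 + i)%N.
  by rewrite size_cat ltn_add2l.
by rewrite nth_cat ltnNge leq_addr /= addKn (set_nth_default N2).
Qed.

Definition rep_of (V : frep F gT) : rep.
Proof.
by apply: (@Representation _ _ _ #|fB V| (@MxRepresentation _ _ _ _ (fR V) _));
  split=> [|g h _ _]; [apply: fR1 | apply: fRM].
Defined.

Lemma mret_rep_of V W : V <| W -> mret (rep_of V) (rep_of W).
Proof. by move=> [i [r [hi hr ir]]]; exists i, r. Qed.

(** The projections [p a] onto the copies of [T] and the inclusions [q a] decompose the identity as
    the sum of the [p a *m q a], so an indecomposable summand sits in a single copy. *)
Lemma mret_triv N (T : frep F gT) (A : finType) :
  indecomposable N -> mret N (rep_of (tens T (triv F gT A))) -> mret N (rep_of T).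
Proof.
move=> indN [i [r [hi hr ir]]].
pose p (a : A) := mxf (fun (y : fB T * A) (t : fB T) => (y == (t, a))%:R : F).
pose q (a : A) := mxf (fun (t : fB T) (y : fB T * A) => (y == (t, a))%:R : F).
have pE a y t : ent (p a) y t = (y == (t, a))%:R by exact: ent_mxf.
have qE a t y : ent (q a) t y = (y == (t, a))%:R by exact: ent_mxf.
have [|||_ NT] := @mret_sum N A (fun=> rep_of T) (fun a => i *m p a)
  (fun a => q a *m r) indN.
- move=> a; apply: (intertwinesM hi) => g /=; apply: entP => -[t b] t'.
  rewrite !ent_mul (bigD1 (t', a)) //= pE eqxx mulr1 big1 ?addr0 => [|y]; last first.
    by rewrite pE => /negPf->; rewrite mulr0.
  rewrite ent_mxf /= ent1 [RHS](bigD1 t) //= pE xpair_eqE eqxx /= mulrC.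
  rewrite [X in _ = _ + X]big1 ?addr0 // => t'' /negPf ne_t.
  by rewrite pE xpair_eqE eq_sym ne_t mul0r.
- move=> a; apply: (intertwinesM _ hr) => g /=; apply: entP => t' [t b].
  rewrite !ent_mul [RHS](bigD1 (t', a)) //= qE eqxx mul1r.
  rewrite [X in _ = _ + X]big1 ?addr0 => [|y]; last first.
    by rewrite qE => /negPf->; rewrite mul0r.
  rewrite ent_mxf /= ent1 (bigD1 t) //= qE xpair_eqE eqxx /= eq_sym.
  rewrite big1 ?addr0 // => t'' /negPf ne_t.
  by rewrite qE xpair_eqE eq_sym ne_t mulr0.
- rewrite -ir; transitivity (i *m (\sum_a p a *m q a) *m r).
    by rewrite mulmx_sumr mulmx_suml; apply: eq_bigr => a _; rewrite !mulmxA.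
  rewrite (_ : \sum_a p a *m q a = 1%:M) ?mulmx1 //.
  apply: entP => -[t a] [t' a']; rewrite ent_sum ent1 (bigD1 a) //= big1 ?addr0.
    rewrite ent_mul (bigD1 t) //= big1 ?addr0 => [|t'' /negPf ne_t].
      by rewrite pE qE eqxx mul1r eq_sym.
    by rewrite pE xpair_eqE eq_sym ne_t mul0r.
  move=> a'' /negPf ne_a; rewrite ent_mul big1 // => t'' _.
  by rewrite pE xpair_eqE [a == _]eq_sym ne_a andbF mul0r.
exact: NT.
Qed.

End KrullSchmidt.

(** * Indices in the tensor product of matrices *)

Section TensorIndices.

Variable F : fieldType.

Lemma pair_ord_subproof m n (i : 'I_m) (j : 'I_n) : (i * n + j < m * n)%N.
Proof.
rewrite (@leq_trans (i * n + n)) ?ltn_add2l // -mulSnr leq_mul2r.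
by rewrite ltn_ord orbT.
Qed.

(** The lexicographic position at which the recursive definition of [tprod] places a pair of
    indices. *)
Definition pair_ord m n (ij : 'I_m * 'I_n) : 'I_(m * n) :=
  Ordinal (pair_ord_subproof ij.1 ij.2).

Lemma pair_ord_bij m n : bijective (@pair_ord m n).
Proof.
apply: inj_card_bij; last by rewrite card_prod !card_ord.
move=> [i j] [i' j'] /(congr1 val) /= eq_ij; congr (_, _); apply: val_inj => /=.
  have := congr1 (divn^~ n) eq_ij; rewrite /= !divnMDl ?(leq_trans _ (ltn_ord j)) //.
  by rewrite !divn_small // !addn0.
by have := congr1 (modn^~ n) eq_ij; rewrite /= !modnMDl !modn_small.
Qed.

Lemma trow_pair_ord n1 (A : 'rV[F]_n1) m2 n2 (B : 'M[F]_(m2, n2)) i j1 j2 :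
  trow A B i (pair_ord (j1, j2)) = A 0 j1 * B i j2.
Proof.
elim: n1 A j1 => [|n1 IHn] A j1; first by case: j1.
have [j|] := unliftP ord0 j1 => ->.
  have -> : pair_ord (lift ord0 j, j2) = rshift n2 (pair_ord (j, j2)).
    by apply: val_inj; rewrite /= mulSn addnA.
  rewrite [LHS](@row_mxEr _ _ n2 (n1 * n2)) IHn mxE; congr (A 0 _ * _).
  by apply: val_inj.
have -> : pair_ord (ord0, j2) = lshift (n1 * n2) j2 by apply: val_inj.
rewrite [LHS](@row_mxEl _ _ n2 (n1 * n2)) !mxE; congr (A 0 _ * _).
by apply: val_inj.
Qed.

Lemma tprod_pair_ord m1 n1 (A : 'M[F]_(m1, n1)) m2 n2 (B : 'M[F]_(m2, n2))
    i1 i2 j1 j2 :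
  tprod A B (pair_ord (i1, i2)) (pair_ord (j1, j2)) = A i1 j1 * B i2 j2.
Proof.
elim: m1 A i1 => [|m1 IHm] A i1; first by case: i1.
have [i|] := unliftP ord0 i1 => ->.
  have -> : pair_ord (lift ord0 i, i2) = rshift m2 (pair_ord (i, i2)).
    by apply: val_inj; rewrite /= mulSn addnA.
  rewrite [LHS](@col_mxEd _ m2 (m1 * m2)) IHm mxE; congr (A _ _ * _).
  by apply: val_inj.
have -> : pair_ord (ord0, i2) = lshift (m1 * m2) i2 by apply: val_inj.
rewrite [LHS](@col_mxEu _ m2 (m1 * m2)) trow_pair_ord mxE; congr (A _ _ * _).
by apply: val_inj.
Qed.

End TensorIndices.

(** * From domination by a fixed module to algebraicity *)

Section Algebraic.

Variables (F : fieldType) (gT : finGroupType).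
Local Notation rep := (representation F [set: gT]).
Implicit Types M N : rep.

Lemma mret_bij M (V : frep F gT) (f : fB V -> 'I_(rdegree M)) :
    bijective f ->
    (forall g a b, M g (f a) (f b) = ent (fR V g) a b) ->
  mret M (rep_of V) /\ mret (rep_of V) M.
Proof.
move=> [f' fK f'K] eqMV.
pose P : 'M[F]_(rdegree M, rdegree (rep_of V)) :=
  \matrix_(i, j) (j == enum_rank (f' i))%:R.
pose Q : 'M[F]_(rdegree (rep_of V), rdegree M) :=
  \matrix_(i, j) (j == f (enum_val i))%:R.
have fE i j : (i == f (enum_val j)) = (j == enum_rank (f' i)).
  apply/eqP/eqP=> ->; first by rewrite fK enum_valK.
  by rewrite enum_rankK f'K.
have mulPE n (B : 'M[F]_(rdegree (rep_of V), n)) i j :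
    (P *m B) i j = B (enum_rank (f' i)) j.
  rewrite mxE (bigD1 (enum_rank (f' i))) //= big1 ?addr0 => [|k /negPf ne_k].
    by rewrite mxE eqxx mul1r.
  by rewrite mxE ne_k mul0r.
have mulEP n (B : 'M[F]_(n, rdegree M)) i j :
    (B *m P) i j = B i (f (enum_val j)).
  rewrite mxE (bigD1 (f (enum_val j))) //= big1 ?addr0 => [|k /negPf ne_k].
    by rewrite mxE -fE eqxx mulr1.
  by rewrite mxE -fE ne_k mulr0.
have mulQE n (B : 'M[F]_(rdegree M, n)) i j :
    (Q *m B) i j = B (f (enum_val i)) j.
  rewrite mxE (bigD1 (f (enum_val i))) //= big1 ?addr0 => [|k /negPf ne_k].
    by rewrite mxE eqxx mul1r.
  by rewrite mxE ne_k mul0r.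
have PQ : P *m Q = 1%:M.
  by apply/matrixP=> i j; rewrite mulPE !mxE enum_rankK f'K eq_sym.
have QP : Q *m P = 1%:M.
  by apply/matrixP=> i j; rewrite mulQE !mxE fK enum_valK eq_sym.
have hP : intertwines P.
  move=> g; apply/matrixP=> i j; rewrite mulPE mulEP -[in LHS](f'K i) eqMV.
  by rewrite /ent enum_valK.
have hQ : intertwines Q.
  move=> g; rewrite -[LHS]mul1mx -QP -(mulmxA Q) (mulmxA P) -hP.
  by rewrite -(mulmxA (M g)) PQ mulmx1.
by split; [exists P, Q | exists Q, P].
Qed.

Definition frep_of M : frep F gT.
Proof.
apply: (@FRep _ _ 'I_(rdegree M) (fun g => mxf (fun i j => M g i j))) => [|g h].
  by apply: entP => i j; rewrite ent_mxf ent1 repr_mx1 mxE.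
apply: entP => i j; rewrite ent_mul ent_mxf repr_mxM ?inE // mxE.
by apply: eq_bigr => k _; rewrite !ent_mxf.
Defined.

Lemma mret_frep_of M : mret M (rep_of (frep_of M)) /\ mret (rep_of (frep_of M)) M.
Proof.
apply: (@mret_bij M (frep_of M) id); first by exists id.
by move=> g a b; rewrite ent_mxf.
Qed.

Lemma mret_prod M N (V W : frep F gT) :
  mret M (rep_of V) -> mret N (rep_of W) ->
  mret (Representation (prod_repr M N)) (rep_of (tens V W)).
Proof.
move=> [i [r [hi hr ir]]] [i' [r' [hi' hr' ir']]].
apply: (@mret_trans _ _ _ (Representation (prod_repr (rep_of V) (rep_of W)))).
  exists (tprod i i'), (tprod r r'); split=> [g|g|] /=; rewrite -!tprodE.
  - by rewrite (hi g) (hi' g).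
  - by rewrite (hr g) (hr' g).
  by rewrite ir ir' tprod1.
pose f (y : fB (tens V W)) := pair_ord (enum_rank y.1, enum_rank y.2).
have [//||//] := @mret_bij (Representation (prod_repr (rep_of V) (rep_of W)))
  (tens V W) f.
  have [p' pK p'K] := pair_ord_bij #|fB V| #|fB W|.
  exists (fun k => (enum_val (p' k).1, enum_val (p' k).2)) => [[v w]|k].
    by rewrite /f pK /= !enum_rankK.
  by rewrite /f /= !enum_valK -surjective_pairing p'K.
by move=> g [a b] [a' b']; rewrite ent_mxf /f tprod_pair_ord.
Qed.

Lemma mret_tensor_power M j :
  mret (tensor_power M j) (rep_of (tpow (frep_of M) j)).
Proof.
elim: j => [|j IHj]; last by apply: mret_prod IHj; case: (mret_frep_of M).
have [||//] := @mret_bij (trivial_grepr F [set: gT]) (triv F gT unit) (fun=> ord0).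
  by exists (fun=> tt) => [[]|i] //; rewrite (ord1 i).
by move=> g [] []; rewrite mxE ent1.
Qed.

Lemma algf_algebraic M : algf (frep_of M) -> algebraic_module M.
Proof.
move=> [T algT]; have [s hs] := finite_indecomposables (rep_of T).
exists (size s), (fun i => nth (rep_of T) s i) => j N indN [N' simM].
have NM : mret N (tensor_power M j).
  exact: mret_trans (mret_daddl N N') (mret_rsim (mx_rsim_sym simM)).
have [A TA] := algT j.
have NT := mret_trans (mret_trans NM (mret_tensor_power M j)) (mret_rep_of TA).
have [i i_lt simN] := hs N indN (mret_triv indN NT).
by exists (Ordinal i_lt).
Qed.

End Algebraic.

(** * Separability of semisimple modules *)

Section Separation.

Variables (F : fieldType) (hT : finGroupType).
Implicit Types U V E M : frep F hT.

Definition full V := forall X : 'M[F]_#|fB V|, exists f, act V f = X.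

Definition ann (l : seq (frep F hT)) (f : hT -> F) :=
  forall U, List.In U l -> act U f = 0.

Definition separable M := exists E A (u v : fB E -> hT -> F),
  E <| tens M (triv F hT A) /\ separates u v M.

(** Each clause of [separates] says that some element of the group algebra acts as zero, so it
    passes to any module killed by the annihilator of [l]. *)
Lemma separates_ann l E (u v : fB E -> hT -> F) V :
    (forall f, ann l f -> act V f = 0) ->
  (forall U, List.In U l -> separates u v U) -> separates u v V.
Proof.
move=> annV sepl.
have eqV f f' : (forall U, List.In U l -> act U f = act U f') -> act V f = act V f'.
  move=> eqff'; apply/eqP; rewrite -subr_eq0 -actB; apply/eqP/annV => U lU.
  by rewrite actB eqff' ?subrr.
split=> [a h|b h|].
- rewrite -act_sum; apply: eqV => U /sepl[sepU _ _]; rewrite act_sum; exact: sepU.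
- rewrite -(act_sum V (fun a => ent (fR E h) a b)); apply: eqV => U /sepl[_ sepU _].
  by rewrite act_sum; apply: sepU.
transitivity (\sum_a 1 *: act V (conv (v a) (u a))).
  by apply: eq_bigr => a _; rewrite scale1r.
rewrite -act_sum -(fR1 V) -(act_delta V); apply: eqV => U /sepl[_ _ sepU].
rewrite act_sum act_delta fR1 -sepU.
by apply: eq_bigr => a _; rewrite scale1r.
Qed.

(* A two-sided ideal of a full matrix algebra is zero or contains 1. *)
Lemma ann_idem l V f :
    full V -> ann l f -> act V f <> 0 ->
  exists w, ann l w /\ act V w = 1%:M.
Proof.
move=> fullV annf /eqP nzf.
have [i [j nz_ij]] : exists i j, act V f i j != 0.
  apply: NNPP => no_ij; case/eqP: nzf; apply/matrixP=> i j; rewrite mxE.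
  by apply/eqP/negbNE/negP=> nz; apply: no_ij; exists i, j.
have /fin_all_exists[x Ex] k : exists g, act V g = (act V f i j)^-1 *: delta_mx k i.
  exact: fullV.
have /fin_all_exists[y Ey] k : exists g, act V g = delta_mx j k.
  exact: fullV.
(* On [V] this acts as [sum_k a^-1 e_(k,i) f e_(j,k) = sum_k e_(k,k)], where [a] is the nonzero
   entry [(i, j)] of [f]; on [l] it acts as zero since [f] does. *)
exists (fun h => \sum_k 1 * conv (x k) (conv f (y k)) h); split=> [U lU|].
  rewrite act_sum big1 // => k _; rewrite !act_conv annf //.
  by rewrite mul0mx mulmx0 scaler0.
rewrite act_sum mx1_sum_delta; apply: eq_bigr => k _.
rewrite scale1r !act_conv Ex Ey -scalemxAl.
have -> : delta_mx k i *m (act V f *m delta_mx j k) =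
    act V f i j *: delta_mx k k :> 'M[F]_#|fB V|.
  rewrite -(mul_delta_mx (0 : 'I_1) k i) -(mul_delta_mx (0 : 'I_1) j k).
  rewrite !mulmxA -(mulmxA (delta_mx k 0)) -rowE -(mulmxA (delta_mx k 0)) -colE.
  rewrite [col j _]mx11_scalar !mxE mul_mx_scalar -scalemxAl mul_delta_mx.
  by [].
by rewrite scalerA mulVf // scale1r.
Qed.

(* Either the relations defining [separates] pass from [l] to [V], or some
   element [w] of the group algebra acts as 0 on [l] and as 1 on [V]; then [w]
   and [1 - w] glue [u], [v] to the matrix units of [V]. *)
Lemma separates_cons M l V E A (u v : fB E -> hT -> F) :
    V <| M -> full V -> E <| tens M (triv F hT A) ->
    (forall U, List.In U l -> separates u v U) ->
  exists E' A' (u' v' : fB E' -> hT -> F), E' <| tens M (triv F hT A') /\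
    forall U, List.In U (V :: l) -> separates u' v' U.
Proof.
move=> VM fullV EM sepl.
have [annV|] := classic (forall f, ann l f -> act V f = 0).
  exists E, A, u, v; split=> // U [<-|]; last exact: sepl.
  exact: separates_ann sepl.
move/not_all_ex_not=> [f nf].
have [annf nzf] : ann l f /\ act V f <> 0 := imply_to_and _ _ nf.
have [w [annw w1]] := ann_idem fullV annf nzf.
(* The elements [y c] and [x c] below act as [e_(c,o)] and [e_(o,c)]: this is the standard
   separability idempotent [sum_c e_(c,o) (x) e_(o,c)] of a matrix algebra. Its right factors form
   row [o], a copy of [V], so [V] is the new summand of [E']. *)
have [o _] : exists o : fB V, True.
  case: (pickP (fun _ : fB V => true)) => [o _|noV]; first by exists o.
  case: nzf; apply/matrixP=> i; have := noV (enum_val i); by [].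
have mxu b c : exists g, act V g = delta_mx (enum_rank b) (enum_rank c).
  exact: fullV.
have /fin_all_exists[x Ex] c := mxu o c.
have /fin_all_exists[y Ey] b := mxu b o.
pose w' (h : hT) : F := delta F 1%g h - w h.
pose E' := dsum V E.
pose u' (a : fB E') := match a with
  inl c => conv w (x c) | inr a => conv (u a) w' end.
pose v' (a : fB E') := match a with
  inl c => conv w (y c) | inr a => conv w' (v a) end.
have w'V : act V w' = 0 by rewrite actB act_delta fR1 w1 subrr.
have w'l U : List.In U l -> act U w' = 1%:M.
  by move=> lU; rewrite actB act_delta fR1 annw // subr0.
have entE h a b : ent (fR E' h) a b = match a, b with
    | inl a, inl b => ent (fR V h) a b
    | inr a, inr b => ent (fR E h) a b
    | _, _ => 0 end by exact: ent_mxf.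
exists E', (option A), u', v'; split=> [|U].
  apply: ret_trans (dsum_triv_option _ _).
  exact: ret_dsum.
case=> [<-{U}|lU].
  have uV a : act V (u' a) = match a with
      inl c => delta_mx (enum_rank o) (enum_rank c) | inr _ => 0 end.
    by case: a => a; rewrite act_conv ?w1 ?mul1mx ?Ex // w'V mulmx0.
  have vV a : act V (v' a) = match a with
      inl c => delta_mx (enum_rank c) (enum_rank o) | inr _ => 0 end.
    by case: a => a; rewrite act_conv ?w1 ?mul1mx ?Ey // w'V mul0mx.
  split=> [a h|b h|].
  - rewrite act_conv act_delta uV big_sumType /=.
    rewrite [X in _ = _ + X]big1 => [|b _]; last first.
      by rewrite (uV (inr b)) scaler0.
    rewrite addr0; case: a => a; last first.
      by rewrite mul0mx big1 // => b _; rewrite entE scale0r.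
    apply: entP => b c; rewrite ent_sum ent_mul.
    rewrite (bigD1 a) //= [X in _ + X]big1 ?addr0 => [|d ne_d]; last first.
      by rewrite /ent mxE (inj_eq enum_rank_inj d) (negPf ne_d) andbF mul0r.
    rewrite (bigD1 c) //= [X in _ = _ + X]big1 ?addr0 => [|d ne_d]; last first.
      rewrite entZ entE (uV (inl d)) /ent mxE (inj_eq enum_rank_inj _ d).
      rewrite (eq_sym c) (negPf ne_d).
      by rewrite andbF mulr0.
    by rewrite entZ entE (uV (inl c)) /ent !mxE !eqxx !andbT mulrC.
  - rewrite act_conv act_delta vV big_sumType /=.
    rewrite [X in _ = _ + X]big1 => [|a _]; last first.
      by rewrite (vV (inr a)) scaler0.
    rewrite addr0; case: b => b; last first.
      by rewrite mulmx0 big1 // => a _; rewrite entE scale0r.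
    apply: entP => a c; rewrite ent_sum ent_mul.
    rewrite (bigD1 b) //= [X in _ + X]big1 ?addr0 => [|d ne_d]; last first.
      by rewrite /ent !mxE (inj_eq enum_rank_inj d) (negPf ne_d) mulr0.
    rewrite (bigD1 a) //= [X in _ = _ + X]big1 ?addr0 => [|d ne_d]; last first.
      rewrite entZ entE (vV (inl d)) /ent mxE (inj_eq enum_rank_inj a).
      rewrite eq_sym (negPf ne_d).
      by rewrite mulr0.
    by rewrite entZ entE (vV (inl a)) /ent !mxE !eqxx.
  rewrite big_sumType /= [X in _ + X]big1 => [|b _]; last first.
    by rewrite !act_conv w'V mul0mx mul0mx.
  rewrite addr0 mx1_sum_delta (reindex enum_rank) /=; last first.
    by apply: onW_bij; exact: enum_rank_bij.
  apply: eq_bigr => c _; rewrite act_conv (uV (inl c)) (vV (inl c)).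
  exact: mul_delta_mx.
have uU a : act U (u' a) = if a is inr a then act U (u a) else 0.
  by case: a => a; rewrite act_conv ?(annw _ lU) ?mul0mx // w'l ?mulmx1.
have vU a : act U (v' a) = if a is inr a then act U (v a) else 0.
  by case: a => a; rewrite act_conv ?(annw _ lU) ?mul0mx // w'l ?mul1mx.
have [sep1 sep2 sep3] := sepl U lU; split=> [a h|b h|].
- rewrite act_conv act_delta uU big_sumType /= big1 => [|b _]; last first.
    by rewrite (uU (inl b)) scaler0.
  rewrite add0r; case: a => a.
    by rewrite mul0mx big1 // => b _; rewrite entE scale0r.
  rewrite -[in LHS](act_delta U) -act_conv sep1.
  by apply: eq_bigr => b _; rewrite entE (uU (inr b)).
- rewrite act_conv act_delta vU big_sumType /= big1 => [|a _]; last first.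
    by rewrite (vU (inl a)) scaler0.
  rewrite add0r; case: b => b.
    by rewrite mulmx0 big1 // => a _; rewrite entE scale0r.
  rewrite -[in LHS](act_delta U) -act_conv sep2.
  by apply: eq_bigr => a _; rewrite entE (vU (inr a)).
rewrite big_sumType /= big1 => [|b _]; last first.
  by rewrite !act_conv (annw _ lU) mul0mx mul0mx.
rewrite add0r -sep3; apply: eq_bigr => a _.
by rewrite act_conv (uU (inr a)) (vU (inr a)) -act_conv.
Qed.

Lemma separable_list M l :
    (forall V, List.In V l -> full V /\ V <| M) ->
    (forall f, ann l f -> act M f = 0) ->
  separable M.
Proof.
move=> hl annM.
suffices [E [A [u [v [EM sepl]]]]] : exists E A (u v : fB E -> hT -> F),
    E <| tens M (triv F hT A) /\ forall U, List.In U l -> separates u v U.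
  by exists E, A, u, v; split=> //; apply: separates_ann sepl.
elim: l hl {annM} => [|V l IHl] hl.
  exists (tens M (triv F hT void)), void, (fun _ _ => 0), (fun _ _ => 0).
  by split; first exact: ret_refl.
have [E [A [u [v [EM sepl]]]]] := IHl (fun U lU => hl U (or_intror lU)).
have [fullV VM] := hl V (or_introl erefl).
exact: separates_cons VM fullV EM sepl.
Qed.

End Separation.

Section Ordinals.

Variable F : fieldType.

Definition mxo m n (X : 'M[F]_(m, n)) := mxf (fun i j => X i j).

Lemma mxoM m n q (X : 'M[F]_(m, n)) (Y : 'M[F]_(n, q)) :
  mxo (X *m Y) = mxo X *m mxo Y.
Proof.
apply: entP => i j; rewrite ent_mul ent_mxf mxE.
by apply: eq_bigr => k _; rewrite !ent_mxf.
Qed.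

Lemma mxo1 n : mxo (1%:M : 'M_n) = 1%:M.
Proof. by apply: entP => i j; rewrite ent_mxf ent1 mxE. Qed.

Lemma mxo_sum m n (I : finType) (c : I -> F) (X : I -> 'M[F]_(m, n)) :
  mxo (\sum_i c i *: X i) = \sum_i c i *: mxo (X i).
Proof.
apply: entP => i j; rewrite ent_sum ent_mxf summxE.
by apply: eq_bigr => k _; rewrite entZ ent_mxf mxE.
Qed.

Lemma mxo0 m n (X : 'M[F]_(m, n)) : mxo X = 0 -> X = 0.
Proof.
move=> X0; apply/matrixP=> i j; rewrite mxE -(ent_mxf (fun i j => X i j)).
by rewrite -/(mxo X) X0 /ent mxE.
Qed.

Lemma mxoE m n (X : 'M[F]_(#|'I_m|, #|'I_n|)) :
  mxo (\matrix_(i, j) ent X i j) = X.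
Proof. by apply: entP => i j; rewrite ent_mxf mxE. Qed.

End Ordinals.

(** * Semisimple modules over an algebraically closed field are separable *)

Section Semisimple.

Variables (F : closedFieldType) (gT hT : finGroupType) (Y : {group gT}).
Variable phi : hT -> gT.
Hypothesis phiM : {morph phi : x y / (x * y)%g}.
Hypothesis phi_inj : injective phi.
Hypothesis phi_im : forall g, reflect (exists h, g = phi h) (g \in Y).

Let phiY h : phi h \in Y. Proof. by apply/phi_im; exists h. Qed.

Section Restriction.
Variables (n : nat) (rY : mx_representation F Y n).

Lemma res_fR1 : mxo (rY (phi 1%g)) = 1%:M.
Proof.
have -> : phi 1%g = 1%g by apply: (mulgI (phi 1%g)); rewrite -phiM !mulg1.
by rewrite repr_mx1 mxo1.
Qed.

Lemma res_fRM g h : mxo (rY (phi (g * h)%g)) = mxo (rY (phi g)) *m mxo (rY (phi h)).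
Proof. by rewrite phiM repr_mxM // mxoM. Qed.

Definition res : frep F hT := @FRep F hT 'I_n _ res_fR1 res_fRM.

Lemma act_res f : act res f = mxo (\sum_h f h *: rY (phi h)).
Proof. by rewrite mxo_sum. Qed.

(** Burnside's theorem: over an algebraically closed field an irreducible representation is
    absolutely irreducible, so its operators span all matrices. *)
Lemma full_res : mx_irreducible rY -> full res.
Proof.
move=> irrY X.
have /mx_abs_irrP[_ [a aE]] := group_closure_closed_field irrY.
exists (fun h => a (phi h) (\matrix_(i, j) ent X i j)).
rewrite act_res -[RHS]mxoE; congr mxo; rewrite [RHS]aE.
rewrite (reindex_onto phi (fun g => odflt 1%g [pick h | phi h == g])) /=.
  apply: eq_bigl => h; rewrite phiY /=.
  by case: pickP => [h' /eqP/phi_inj-> | /(_ h)]; rewrite eqxx.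
move=> g /phi_im[h ->]; case: pickP => [h' /eqP // | /(_ h)].
by rewrite eqxx.
Qed.

End Restriction.

(** The list consists of the simple submodules whose sum is the module: each is full, has a
    complement by semisimplicity, and an element killing all of them kills their sum. *)
Lemma separable_res n (rY : mx_representation F Y n) :
  mxsemisimple rY 1%:M -> separable (res rY).
Proof.
move=> ss; have := mxsemisimple_reducible ss; case: ss => I U W simU defW _ redY.
have modU i : mxmodule rY (U i) by case: (simU i).
pose V i := res (submod_repr (modU i)).
apply: (@separable_list _ _ _ [seq V i | i <- enum I])
  => [_ /List.in_map_iff[i [<- _]]|f annf].
  split; first by apply/full_res/submod_mx_irr.
  have [W' modW' defW' dxW'] := redY (U i) (modU i) (submx1 _).
  have := @mx_rsim_dadd _ _ _ _ rY _ _ _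
    (Representation (submod_repr (modU i))) (Representation (submod_repr modW'))
    _ _ (mxmodule1 rY) defW' dxW' (mx_rsim_refl _) (mx_rsim_refl _).
  move/(mx_rsim_trans (mx_rsim_sym (rsim_submod1 (mxmodule1 rY) (eqmx_refl _)))).
  case/mx_rsim_def=> B [B' B'B homB].
  have homB1 x : x \in Y ->
      rY x *m B = B *m dadd_grepr (Representation (submod_repr (modU i)))
                         (Representation (submod_repr modW')) x.
    by move=> Yx; rewrite homB // -!mulmxA B'B mulmx1.
  have homB2 x : x \in Y ->
      B' *m rY x = dadd_grepr (Representation (submod_repr (modU i)))
                         (Representation (submod_repr modW')) x *m B'.
    by move=> Yx; rewrite homB // !mulmxA B'B mul1mx.
  exists (mxo (row_mx 1%:M 0 *m B')), (mxo (B *m col_mx 1%:M 0)).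
  split=> [h|h|] /=; rewrite -!mxoM.
  - congr mxo; rewrite -[RHS]mulmxA homB2 //= !mulmxA; congr (_ *m _).
    by rewrite mul_mx_row mul_row_block !mulmx0 !mul1mx mulmx1 mul0mx !addr0.
  - congr mxo; rewrite [LHS]mulmxA homB1 //= -!mulmxA; congr (_ *m _).
    by rewrite mul_block_col mul_col_mx !mulmx1 !mul0mx !mul1mx mulmx0 !addr0.
  rewrite -mulmxA (mulmxA B') B'B mul1mx mul_row_col mulmx1 mul0mx addr0.
  exact: mxo1.
rewrite act_res; set A := \sum_h _.
suffices -> : A = 0 by apply: entP => i j; rewrite ent_mxf /ent !mxE.
have : (1%:M <= kermx A)%MS.
  rewrite -defW; apply/sumsmx_subP=> i _; apply/sub_kermxP.
  have Vi0 : \sum_h f h *: submod_repr (modU i) (phi h) = 0.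
    apply: mxo0; rewrite -act_res; refine (annf (V i) _); apply/List.in_map_iff.
    exists i; split=> //; elim: (enum I) (mem_enum I i) => // j s IHs.
    by rewrite inE => /orP[/eqP->|/IHs]; [left | right].
  have Ui0 : val_submod (1%:M : 'M_(\rank (U i))) *m A = 0.
    rewrite /A mulmx_sumr.
    transitivity (val_submod (\sum_h f h *: submod_repr (modU i) (phi h)));
      last by rewrite Vi0 linear0.
    rewrite linear_sum; apply: eq_bigr => h _; rewrite -scalemxAr [RHS]linearZ /=.
    by rewrite -val_submodJ // mul1mx.
  have /submxP[D ->] : (U i <= val_submod (1%:M : 'M_(\rank (U i))))%MS.
    by rewrite val_submod1.
  by rewrite -mulmxA Ui0 mulmx0.
by move/sub_kermxP; rewrite mul1mx.
Qed.

End Semisimple.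

(** * Modules of a cyclic group of order p in characteristic p *)

Section CyclicPrimeOrder.

Variables (F : fieldType) (p : nat).
Hypothesis charF : p \in [pchar F].

Let p_pr : prime p := pcharf_prime charF.

Lemma frobenius_mx n (X : 'M[F]_n) : (X + 1) ^+ p = X ^+ p + 1.
Proof.
have p_gt0 := prime_gt0 p_pr.
rewrite exprD1n -(big_mkord predT (fun i => X ^+ i *+ 'C(p, i))).
rewrite big_nat_recr //= big_ltn // bin0 binn expr0 !mulr1n.
rewrite big_nat_cond big1 => [|i /andP[/andP[i_gt0 i_lt] _]].
  by rewrite addr0 addrC.
have /dvdnP[c ->] : (p %| 'C(p, i))%N by apply: prime_dvd_bin; rewrite // i_gt0.
by rewrite mulrnA -scaler_nat (pcharf0 charF) scale0r.
Qed.

(* The group law of ['Z_p], written multiplicatively, is addition. *)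
Section PowerRep.
Variables (B : finType) (A : 'M[F]_#|B|).
Hypothesis Ap : A ^+ p = 1.

Lemma pow_fR1 : A ^+ (1%g : 'Z_p) = 1%:M. Proof. by []. Qed.

Lemma pow_fRM (g h : 'Z_p) : A ^+ (g * h)%g = A ^+ g *m A ^+ h.
Proof.
have Ap' : A ^+ (Zp_trunc p).+2 = 1 by rewrite Zp_cast ?prime_gt1.
by rewrite -[RHS](exprD A) -(expr_mod (g + h)%N Ap').
Qed.

Definition pow_rep : frep F 'Z_p :=
  @FRep F 'Z_p B (fun k : 'Z_p => A ^+ k) pow_fR1 pow_fRM.

End PowerRep.

Lemma intertwine_exp m n (A : 'M[F]_m) (C : 'M[F]_n) (X : 'M[F]_(m, n)) k :
  A *m X = X *m C -> A ^+ k *m X = X *m C ^+ k.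
Proof.
move=> AX; elim: k => [|k IHk]; first by rewrite !expr0 mul1mx mulmx1.
have expSl q (D : 'M[F]_q) : D ^+ k.+1 = D *m D ^+ k by rewrite exprS.
by rewrite !expSl -mulmxA IHk !mulmxA AX.
Qed.

Lemma repr_nat n (rW : mx_representation F [set: 'Z_p] n) m :
  rW (m%:R : 'Z_p) = rW Zp1 ^+ m.
Proof.
elim: m => [|m IHm]; first exact: repr_mx1.
have -> : m.+1%:R = (Zp1 * m%:R :> 'Z_p)%g by rewrite -natr1 addrC.
by rewrite repr_mxM ?inE // IHm exprS.
Qed.

Lemma repr_exp n (rW : mx_representation F [set: 'Z_p] n) (k : 'Z_p) :
  rW k = rW Zp1 ^+ k.
Proof. by rewrite -repr_nat natr_Zp. Qed.

Lemma repr_exp_order n (rW : mx_representation F [set: 'Z_p] n) :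
  rW Zp1 ^+ p = 1.
Proof. by rewrite -repr_nat pchar_Zp ?prime_gt1 //; apply: repr_mx1. Qed.

Definition shift m : 'M[F]_m := \matrix_(i, j) (j == i.+1 :> nat)%:R.

Lemma mul_shift m n (X : 'M[F]_(m, n)) (i : 'I_m) j (lt_i : (i.+1 < m)%N) :
  (shift m *m X) i j = X (Ordinal lt_i) j.
Proof.
rewrite mxE (bigD1 (Ordinal lt_i)) //= mxE eqxx mul1r big1 ?addr0 // => k.
by rewrite -val_eqE mxE => /negPf->; rewrite mul0r.
Qed.

Lemma mul_shift0 m n (X : 'M[F]_(m, n)) (i : 'I_m) j :
  (m <= i.+1)%N -> (shift m *m X) i j = 0.
Proof.
move=> le_m; rewrite mxE big1 // => k _; rewrite mxE.
by rewrite ltn_eqF ?mul0r // (leq_trans (ltn_ord k)).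
Qed.

Lemma mulr_shift m n (X : 'M[F]_(n, m)) i (j : 'I_m) (lt_j : (j.-1 < m)%N) :
  (0 < j)%N -> (X *m shift m) i j = X i (Ordinal lt_j).
Proof.
move=> j_gt0; rewrite mxE (bigD1 (Ordinal lt_j)) //= mxE /= prednK // eqxx mulr1.
rewrite big1 ?addr0 // => k; rewrite -val_eqE mxE /= => /negPf ne_k.
by case: eqP => [Ej|]; [rewrite Ej eqxx in ne_k | rewrite mulr0].
Qed.

Lemma mulr_shift0 m n (X : 'M[F]_(n, m)) i (j : 'I_m) :
  val j = 0%N -> (X *m shift m) i j = 0.
Proof. by move=> j0; rewrite mxE big1 // => k _; rewrite mxE j0 mulr0. Qed.

Lemma shift_nilp m : shift m ^+ m = 0.
Proof.
suffices expE k i j : (shift m ^+ k) i j = (j == (i + k)%N :> nat)%:R.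
  apply/matrixP=> i j; rewrite expE mxE ltn_eqF // ltn_addl //.
elim: k i => [|k IHk] i; first by rewrite mxE addn0 eq_sym.
rewrite exprS; case: (ltnP i.+1 m) => [lt_i|le_m].
  by rewrite (mul_shift _ _ lt_i) IHk /= addSnnS.
rewrite mul_shift0 // ltn_eqF // (leq_trans (ltn_ord j)) // (leq_trans le_m) //.
by rewrite addnS ltnS leq_addr.
Qed.

Lemma jordan_pow m : (m <= p)%N -> (shift m + 1) ^+ p = 1.
Proof.
by move=> le_m; rewrite frobenius_mx -(subnKC le_m) exprD shift_nilp mul0r add0r.
Qed.

Lemma nilp_of_pow n (A : 'M[F]_n) : A ^+ p = 1 -> (A - 1) ^+ p = 0.
Proof.
move=> Ap; apply: (addIr 1); rewrite -frobenius_mx subrK add0r; exact: Ap.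
Qed.

(* The row vectors [v N^a], [a < m], span a copy of the nilpotent Jordan block
   of size [m]; the functionals [x |-> x N^(m - 1 - b) w] split it off since
   the pairing [v N^(a + m - 1 - b) w] is triangular in [a, b]. *)
Lemma jordan_block n (N : 'M[F]_n) m :
    N ^+ m.+1 = 0 -> N ^+ m != 0 ->
  exists (i : 'M_(m.+1, n)) (r : 'M_(n, m.+1)),
    [/\ shift m.+1 *m i = i *m N, N *m r = r *m shift m.+1 & i *m r = 1%:M].
Proof.
move=> Nm1 nzNm.
have [x [y nz_xy]] : exists x y, (N ^+ m) x y != 0.
  apply: NNPP => no_xy; case/eqP: nzNm; apply/matrixP=> x y; rewrite mxE.
  by apply/eqP/negbNE/negP=> nz; apply: no_xy; exists x, y.
have N0 k : (m < k)%N -> N ^+ k = 0.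
  by move=> lt_mk; rewrite -(subnKC lt_mk) exprD Nm1 mul0r.
pose i : 'M[F]_(m.+1, n) := \matrix_(a, j) (N ^+ a) x j.
pose s : 'M[F]_(n, m.+1) := \matrix_(j, b) (N ^+ (m - b)) j y.
have Si : shift m.+1 *m i = i *m N.
  apply/matrixP=> a j; transitivity ((N ^+ a.+1) x j).
    case: (ltnP a.+1 m.+1) => [lt_a|le_m]; first by rewrite (mul_shift _ _ lt_a) mxE.
    by rewrite mul_shift0 // N0 // mxE.
  by rewrite exprSr !mxE; apply: eq_bigr => k _; rewrite mxE.
have sS : N *m s = s *m shift m.+1.
  apply/matrixP=> j b; transitivity ((N ^+ (m - b).+1) j y).
    by rewrite exprS !mxE; apply: eq_bigr => k _; rewrite mxE.
  have [b0|b_gt0] := posnP b.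
    by rewrite mulr_shift0 // N0 ?mxE // b0 subn0.
  have lt_b : (b.-1 < m.+1)%N by rewrite (leq_ltn_trans (leq_pred b)).
  rewrite (mulr_shift _ _ lt_b) // mxE /=; congr ((N ^+ _) _ _).
  by rewrite -subSn ?leq_ord // -{1}(prednK b_gt0) subSS.
pose D := i *m s.
have DE a b : D a b = (N ^+ (a + (m - b))) x y.
  by rewrite exprD !mxE; apply: eq_bigr => k _; rewrite !mxE.
have uD : D \in unitmx.
  rewrite unitmxE -det_tr det_trig; last first.
    apply/is_trig_mxP=> a b lt_ab; rewrite mxE DE N0 ?mxE //.
    by have := lt_ab; rewrite -(ltn_add2r (m - a)) subnKC ?leq_ord.
  rewrite unitfE; apply/prodf_neq0 => a _.
  by rewrite mxE DE subnKC ?leq_ord.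
have SD : shift m.+1 *m D = D *m shift m.+1.
  by rewrite /D mulmxA Si -!mulmxA sS.
(* [D] commutes with the shift, so correcting [s] by its inverse preserves the intertwining
   relation. *)
exists i, (s *m invmx D); split=> //; last by rewrite mulmxA mulmxV.
rewrite mulmxA sS -!mulmxA; congr (_ *m _).
rewrite -[LHS](mulKmx uD); congr (_ *m _).
by rewrite mulmxA -SD mulmxK.
Qed.

(** A unipotent Jordan block of size [m > p] does not have order dividing [p]; the default value [1]
    keeps [jordan_rep] defined for every [m]. *)
Definition jordan_mx m : 'M[F]_m := if (m <= p)%N then shift m + 1 else 1.

Lemma jordan_mx_pow m : jordan_mx m ^+ p = 1.
Proof.
by rewrite /jordan_mx; case: ifP => [/jordan_pow //|_]; rewrite expr1n.
Qed.

Definition jordan_rep m := pow_rep (@jordan_mx_pow #|'I_m|).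

Definition jordan_sum : frep F 'Z_p :=
  foldr (fun m V => dsum (jordan_rep m) V) (triv F 'Z_p void) (iota 0 p.+1).

Lemma ret_dsuml (V W : frep F 'Z_p) : V <| dsum V W.
Proof.
exists (mxf (fun a y => (y == inl a)%:R)), (mxf (fun y a => (y == inl a)%:R)).
have lE (A : finType) (X : 'M[F]_(#|fB V|, #|A|)) y a :
    ent (mxf (fun y a => (y == inl a :> fB V + fB W)%:R) *m X) y a =
    if y is inl v then ent X v a else 0.
  rewrite ent_mul; case: y => v; last by rewrite big1 // => b _; rewrite ent_mxf mul0r.
  rewrite (bigD1 v) //= ent_mxf eqxx mul1r big1 ?addr0 // => b ne_b.
  by rewrite ent_mxf (inj_eq (@inl_inj _ _)) eq_sym (negPf ne_b) mul0r.
have rE (A : finType) (X : 'M[F]_(#|A|, #|fB V|)) a y :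
    ent (X *m mxf (fun a y => (y == inl a :> fB V + fB W)%:R)) a y =
    if y is inl v then ent X a v else 0.
  rewrite ent_mul; case: y => v; last by rewrite big1 // => b _; rewrite ent_mxf mulr0.
  rewrite (bigD1 v) //= ent_mxf eqxx mulr1 big1 ?addr0 // => b ne_b.
  by rewrite ent_mxf (inj_eq (@inl_inj _ _)) eq_sym (negPf ne_b) mulr0.
split=> [g|g|]; apply: entP.
- move=> a y; rewrite rE ent_mul (bigD1 (inl a)) //= ent_mxf eqxx mul1r.
  rewrite ent_mxf big1 ?addr0 => [|b ne_b]; first by case: y.
  by rewrite ent_mxf (negPf ne_b) mul0r.
- move=> y a; rewrite lE ent_mul (bigD1 (inl a)) //= [X in _ * X]ent_mxf eqxx mulr1.
  rewrite ent_mxf big1 ?addr0 => [|b ne_b]; first by case: y.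
  by rewrite [X in _ * X]ent_mxf (negPf ne_b) mulr0.
move=> a b; rewrite ent_mul (bigD1 (inl a)) //= !ent_mxf eqxx mul1r.
rewrite big1 ?addr0 => [|c ne_c]; last by rewrite ent_mxf (negPf ne_c) mul0r.
by rewrite (inj_eq (@inl_inj _ _)) ent1.
Qed.

Lemma ret_dsumC (V W : frep F 'Z_p) : dsum V W <| dsum W V.
Proof.
pose f (x : fB (dsum V W)) : fB (dsum W V) :=
  match x with inl v => inr v | inr w => inl w end.
apply: (ret_bij (f := f)).
  by exists (fun x : fB (dsum W V) =>
    match x with inl v => inr v | inr w => inl w end); case.
by move=> g [v|v] [w|w]; rewrite !ent_mxf.
Qed.

Lemma jordan_rep_sum m : (m <= p)%N -> jordan_rep m <| jordan_sum.
Proof.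
rewrite -ltnS -[(m < _)%N]/(0 <= m < 0 + p.+1)%N -mem_iota /jordan_sum.
elim: (iota 0 p.+1) => // q s IHs; rewrite inE => /predU1P[->|/IHs ms] /=.
  exact: ret_dsuml.
apply: ret_trans ms _; apply: ret_trans (ret_dsumC _ _); exact: ret_dsuml.
Qed.

(** If [M] is indecomposable and [m.+1] is the nilpotency index of [M Zp1 - 1], a block of size
    [m.+1] splits off; the resulting idempotent endomorphism [r *m i] is nonzero, hence [1], and [M]
    is that block. A decomposable [M] follows by induction on the degree. *)
Lemma mret_jordan_sum (M : representation F [set: 'Z_p]) :
  exists B : finType, mret M (rep_of (tens jordan_sum (triv F 'Z_p B))).
Proof.
have [n] := ubnP (rdegree M); elim: n M => // n IHn M /ltnSE le_n.
have [M0|M_gt0] := posnP (rdegree M).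
  exists unit, 0, 0; split=> [g|g|]; rewrite ?mul0mx ?mulmx0 //.
  by apply/matrixP=> x; have := ltn_ord x; rewrite [X in (_ < X)%N]M0.
have [indM|not_indM] := classic (indecomposable M).
  pose N := M Zp1 - 1.
  have Np : exists k, N ^+ k == 0.
    by exists p; rewrite nilp_of_pow // repr_exp_order.
  case: (ex_minnP Np) => -[|m] /eqP Nm minm.
    by have := mxrank1 F (rdegree M); rewrite -[1%:M]/(N ^+ 0) Nm mxrank0
      => /eqP; rewrite ltn_eqF.
  have le_m : (m.+1 <= p)%N.
    by apply: minm; rewrite nilp_of_pow // repr_exp_order.
  have := @jordan_block _ N m Nm.
  have -> : N ^+ m != 0 by apply/negP=> /minm; rewrite ltnn.
  move/(_ isT); rewrite -(card_ord m.+1) => -[i [r [Si Nr ir]]].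
  have jE : jordan_mx #|'I_m.+1| = shift _ + 1.
    by rewrite /jordan_mx [X in (X <= _)%N]card_ord le_m.
  have Ai : jordan_mx #|'I_m.+1| *m i = i *m M Zp1.
    rewrite jE mulmxDl mul1mx -[M Zp1](subrK 1) -/N.
    by rewrite mulmxDr mulmx1 Si.
  have Ar : M Zp1 *m r = r *m jordan_mx #|'I_m.+1|.
    rewrite jE mulmxDr mulmx1 -[M Zp1](subrK 1) -/N.
    by rewrite mulmxDl mul1mx Nr.
  have hi : @intertwines _ _ (rep_of (jordan_rep m.+1)) M i.
    by move=> g; rewrite [M g]repr_exp; apply: intertwine_exp.
  have hr : @intertwines _ _ M (rep_of (jordan_rep m.+1)) r.
    by move=> g; rewrite [M g]repr_exp; apply: intertwine_exp.
  have := indecomposable_idem indM (intertwinesM hr hi).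
  rewrite mulmxA -[r *m i *m r]mulmxA ir mulmx1 => /(_ erefl)[ri|ri].
    have : i *m r *m (i *m r) = 0.
      by rewrite mulmxA -[i *m r *m i]mulmxA ri mulmx0 mul0mx.
    rewrite ir mulmx1 => /(congr1 mxrank); rewrite mxrank1 mxrank0.
    by rewrite card_ord.
  exists unit; apply: (@mret_trans _ _ _ (rep_of (jordan_rep m.+1))).
    by exists r, i.
  apply: mret_rep_of; apply: ret_trans (jordan_rep_sum le_m) _.
  exact: ret_triv_unit.
have [N1 [N2 [simM d1 d2]]] : exists N1 N2 : representation F [set: 'Z_p],
    [/\ mx_rsim M (dadd_grepr N1 N2), 0 < rdegree N1 & 0 < rdegree N2]%N.
  apply: NNPP => noN; apply: not_indM; split=> // N1 N2 simM.
  case: (posnP (rdegree N1)) => [|d1]; first by left.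
  case: (posnP (rdegree N2)) => [|d2]; first by right.
  by case: noN; exists N1, N2.
have degM : rdegree M = (rdegree N1 + rdegree N2)%N := mxrank_rsim simM.
have [|B1 [i1 [r1 [hi1 hr1 ir1]]]] := IHn N1.
  by rewrite (leq_trans _ le_n) // degM -addn1 leq_add2l.
have [|B2 [i2 [r2 [hi2 hr2 ir2]]]] := IHn N2.
  by rewrite (leq_trans _ le_n) // degM -add1n leq_add2r.
(* Multiplicities add: [ll] and [rr] include the copies indexed by [B1] or [B2] among those indexed
   by the disjoint union and project back. *)
pose B12 : finType := (B1 + B2)%type.
exists B12; apply: mret_trans (mret_rsim simM) _.
pose l (B : finType) (f : B -> B12) : 'M[F]_(#|B|, #|B12|) :=
  mxf (fun b y => (y == f b)%:R).
pose ll B f := kron (1%:M : 'M[F]_#|fB jordan_sum|) (@l B f).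
pose rr B f := kron (1%:M : 'M[F]_#|fB jordan_sum|) (@l B f)^T.
have lE (B B' : finType) (f : B -> B12) (f' : B' -> B12) b b' :
    ent (l B f *m (l B' f')^T) b b' = (f b == f' b')%:R.
  rewrite ent_mul (bigD1 (f b)) //= ent_mxf eqxx mul1r big1 ?addr0 => [|y ne_y].
    by rewrite /ent mxE -/(ent _ _ _) ent_mxf.
  by rewrite ent_mxf (negPf ne_y) mul0r.
have lr (B : finType) (f : B -> B12) : injective f -> ll B f *m rr B f = 1%:M.
  move=> f_inj; rewrite kronM mulmx1 -kron1; congr kron.
  by apply: entP => a b; rewrite lE (inj_eq f_inj) ent1.
have lr0 (B B' : finType) (f : B -> B12) (f' : B' -> B12) :
    (forall b b', f b != f' b') -> ll B f *m rr B' f' = 0.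
  move=> nef; rewrite kronM mulmx1.
  apply: entP => -[a b] [a' b'].
  by rewrite ent_mxf /= lE (negPf (nef _ _)) mulr0 /ent mxE.
have hll (B : finType) (f : B -> B12) g :
    fR (tens jordan_sum (triv F 'Z_p B)) g *m ll B f =
    ll B f *m fR (tens jordan_sum (triv F 'Z_p B12)) g.
  by rewrite !kronM !mul1mx !mulmx1.
have hrr (B : finType) (f : B -> B12) g :
    fR (tens jordan_sum (triv F 'Z_p B12)) g *m rr B f =
    rr B f *m fR (tens jordan_sum (triv F 'Z_p B)) g.
  by rewrite !kronM !mul1mx !mulmx1.
exists (col_mx (i1 *m ll B1 inl) (i2 *m ll B2 inr)),
  (row_mx (rr B1 inl *m r1) (rr B2 inr *m r2)); split=> [g|g|].
- rewrite [LHS]mul_block_col !mul0mx addr0 add0r mul_col_mx; congr col_mx.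
    by rewrite mulmxA (hi1 g) -!mulmxA; congr (_ *m _); exact: hll.
  by rewrite mulmxA (hi2 g) -!mulmxA; congr (_ *m _); exact: hll.
- rewrite [RHS]mul_row_block !mulmx0 addr0 add0r mul_mx_row; congr row_mx.
    by rewrite -[RHS]mulmxA -(hr1 g) !mulmxA; congr (_ *m _); exact: hrr.
  by rewrite -[RHS]mulmxA -(hr2 g) !mulmxA; congr (_ *m _); exact: hrr.
rewrite mul_col_row !mulmxA -!(mulmxA _ (ll _ _)).
rewrite !lr ?mulmx1 ?ir1 ?ir2; try by move=> ? ? [].
by rewrite !lr0 // !mulmx0 !mul0mx -scalar_mx_block.
Qed.

Lemma cyclic_finite_type : exists T : frep F 'Z_p,
  forall W : frep F 'Z_p, exists B : finType, W <| tens T (triv F 'Z_p B).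
Proof.
exists jordan_sum => W.
by have [B [i [r [hi hr ir]]]] := mret_jordan_sum (rep_of W); exists B, i, r.
Qed.

End CyclicPrimeOrder.

(** * Symmetric groups *)

Section Transfer.

Variable F : fieldType.

Lemma ret_act (hT : finGroupType) (V W : frep F hT) f :
  V <| W -> act W f = 0 -> act V f = 0.
Proof.
move=> [i [r [hi _ ir]]] W0.
rewrite -[LHS]mulmx1 -ir mulmxA.
have -> : act V f *m i = i *m act W f.
  rewrite mulmx_suml mulmx_sumr; apply: eq_bigr => h _.
  by rewrite -scalemxAl -scalemxAr hi.
by rewrite W0 mulmx0 mul0mx.
Qed.

Lemma ret_separates (hT : finGroupType) (V W E : frep F hT) (u v : fB E -> hT -> F) :
  V <| W -> separates u v W -> separates u v V.
Proof.
move=> VW sepW; apply: (@separates_ann _ _ [:: W]) => [f annf|U [<-|[]]] //.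
by apply: ret_act VW _; apply: annf; left.
Qed.

Lemma ret_separable (hT : finGroupType) (V W : frep F hT) :
  V <| W -> W <| V -> separable W -> separable V.
Proof.
move=> VW WV [E [A [u [v [EW sepW]]]]]; exists E, A, u, v; split.
  by apply: ret_trans EW _; apply: ret_tens => //; apply: ret_refl.
exact: ret_separates sepW.
Qed.

(** The operator of [t] intertwines the restrictions along conjugate embeddings. It serves both for
    the coordinate copies in a wreath product and for symmetric groups of subsets of equal size. *)
Lemma ret_conj (hT gT : finGroupType) (f f' : hT -> gT)
    (fM : {morph f : x y / (x * y)%g}) (f'M : {morph f' : x y / (x * y)%g})
    (V : frep F gT) t :
  (forall h, t * f h = f' h * t)%g -> pull fM V <| pull f'M V.
Proof.
move=> ff'; exists (fR V t^-1%g), (fR V t); split=> [h|h|] /=; last exact: fRK.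
  rewrite -!fRM; congr (fR V _).
  by rewrite -[RHS](mulgK t) -(mulgA t^-1 (f' h))%g -ff' mulKg.
by rewrite -!fRM ff'.
Qed.

Lemma ret_pull_pull (hT gT lT : finGroupType) (f : hT -> gT) (f' : gT -> lT)
    (f'' : hT -> lT) (fM : {morph f : x y / (x * y)%g})
    (f'M : {morph f' : x y / (x * y)%g}) (f''M : {morph f'' : x y / (x * y)%g})
    (V : frep F lT) :
  (forall h, f'' h = f' (f h)) ->
  pull f''M V <| pull fM (pull f'M V) /\ pull fM (pull f'M V) <| pull f''M V.
Proof.
move=> ff'; split.
  apply: (ret_bij (f := (id : fB (pull f''M V) -> fB (pull fM (pull f'M V))))).
    by exists id.
  by move=> g a b /=; rewrite ff'.
apply: (ret_bij (f := (id : fB (pull fM (pull f'M V)) -> fB (pull f''M V)))).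
  by exists id.
by move=> g a b /=; rewrite ff'.
Qed.

(** As the action is transitive, all coordinate copies of [hT] are conjugate under the top group, so
    the [u], [v] obtained at [x0] separate at every coordinate. *)
Lemma algf_wreath (hT kT : finGroupType) (X : finType) (to : {action kT &-> X})
    (x0 : X) (V : frep F (wreath hT to)) (TW : frep F kT) :
    (forall x, exists k, to x k = x0) ->
    separable (pull (wcoordM to x0) V) -> algf (pull (wcoordM to x0) V) ->
    (forall A j, exists B : finType,
       tens (perm_rep hT to F A) (tpow (pull (@wtopM hT kT X to) V) j)
         <| tens TW (triv F kT B)) ->
  algf V.
Proof.
move=> to_x0 [E [A [u [v [EV sepE]]]]] algV algW.
have sep x : separates u v (pull (wcoordM to x) V).
  have [k xk] := to_x0 x; apply: ret_separates sepE.
  apply: (@ret_conj _ _ _ _ _ _ _ (wtop hT to k^-1%g)) => h.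
  rewrite wtop_wbase; congr (wbase _ _ * _)%g; apply/ffunP=> y; rewrite !ffunE.
  by rewrite -{1}(actK to k x) xk (inj_eq (act_inj to _)).
apply: algf_ret (ret_tind_top sep) _.
apply: algf_tind algW.
exact: algf_ret EV (algf_triv _ algV).
Qed.

End Transfer.

(** * Symmetric groups embedded along injections *)

Section Embedding.

Variables (Q Omega : finType) (f : Q -> Omega).
Hypothesis f_inj : injective f.

Definition emb_fun (h : {perm Q}) (z : Omega) : Omega :=
  if [pick y | f y == z] is Some y then f (h y) else z.

Lemma emb_fun_im h y : emb_fun h (f y) = f (h y).
Proof.
rewrite /emb_fun; case: pickP => [y' /eqP/f_inj-> // | /(_ y)].
by rewrite eqxx.
Qed.

Lemma emb_fun_out h z : (forall y, f y != z) -> emb_fun h z = z.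
Proof.
move=> out; rewrite /emb_fun; case: pickP => // y /eqP Ez.
by have := out y; rewrite Ez eqxx.
Qed.

Variant emb_spec (z : Omega) : Prop :=
  | EmbIm y of z = f y
  | EmbOut of forall y, f y != z.

Lemma embP z : emb_spec z.
Proof.
case: (pickP (fun y => f y == z)) => [y /eqP <-|out]; first exact: EmbIm.
by apply: EmbOut => y; rewrite out.
Qed.

Lemma emb_fun_inj h : injective (emb_fun h).
Proof.
move=> z z'; case: (embP z) => [y ->|out]; case: (embP z') => [y' ->|out'].
- by rewrite !emb_fun_im => /f_inj/perm_inj->.
- rewrite emb_fun_im emb_fun_out // => Ez.
  by have := out' (h y); rewrite Ez eqxx.
- rewrite emb_fun_im emb_fun_out // => Ez.
  by have := out (h y'); rewrite Ez eqxx.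
by rewrite !emb_fun_out.
Qed.

Definition emb (h : {perm Q}) : {perm Omega} := perm (@emb_fun_inj h).

Lemma emb_im h y : emb h (f y) = f (h y).
Proof. by rewrite permE emb_fun_im. Qed.

Lemma emb_out h z : (forall y, f y != z) -> emb h z = z.
Proof. by move=> out; rewrite permE emb_fun_out. Qed.

Lemma emb_eq (h : {perm Q}) (s : {perm Omega}) :
    (forall y, s (f y) = f (h y)) -> (forall z, (forall y, f y != z) -> s z = z) ->
  s = emb h.
Proof.
move=> s_im s_out; apply/permP=> z; case: (embP z) => [y ->|out].
  by rewrite emb_im.
by rewrite emb_out ?s_out.
Qed.

Lemma embM : {morph emb : h h' / (h * h')%g}.
Proof.
move=> h h'; apply/esym/emb_eq => [y|z out]; first by rewrite !permM !emb_im.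
by rewrite permM !emb_out // emb_out.
Qed.

Lemma emb1 : emb 1%g = 1%g.
Proof. by apply/esym/emb_eq => [y|z _]; rewrite !perm1. Qed.

Lemma emb_inj : injective emb.
Proof.
move=> h h' eq_hh'; apply/permP=> y; apply: f_inj.
by rewrite -!emb_im eq_hh'.
Qed.

Lemma emb_onto (s : {perm Omega}) :
  (forall z, (forall y, f y != z) -> s z = z) -> exists h, s = emb h.
Proof.
move=> s_out; have /fin_all_exists[h hE] y : exists y', s (f y) = f y'.
  case: (embP (s (f y))) => [y' ->|out]; first by exists y'.
  by have := s_out _ out => /perm_inj Ey; have := out y; rewrite Ey eqxx.
have h_inj : injective h.
  by move=> y y' /(congr1 f); rewrite -!hE => /perm_inj/f_inj.
exists (perm h_inj); apply: emb_eq => // y.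
by rewrite permE hE.
Qed.

End Embedding.

(** Hence the embeddings of [{perm Q}] along [e] and [f] are conjugate. The permutation is built
    point by point: the transposition correcting the value at [e x] moves none of the values already
    prescribed, by injectivity of [e] and [f]. *)
Lemma extend_perm (Q T : finType) (e f : Q -> T) :
  injective e -> injective f -> exists s : {perm T}, forall y, s (e y) = f y.
Proof.
move=> e_inj f_inj.
suffices [s hs] : exists s : {perm T}, forall y, y \in enum Q -> s (e y) = f y.
  by exists s => y; apply: hs; rewrite mem_enum.
elim: (enum Q) (enum_uniq Q) => [|x l IHl] /=; first by exists 1%g.
case/andP=> l'x /IHl[s hs]; exists (s * tperm (s (e x)) (f x))%g => y.
rewrite inE permM => /predU1P[->|ly]; first by rewrite tpermL.
have ne_yx : y != x by apply: contraNneq l'x => <-.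
rewrite (hs y) // tpermD //; last by rewrite eq_sym (inj_eq f_inj).
by rewrite -(hs y) // (inj_eq perm_inj) (inj_eq e_inj) eq_sym.
Qed.

(** * Valuations of factorials and indices prime to the characteristic *)

Section Index.

Variable p : nat.
Hypothesis p_pr : prime p.

(** Legendre's formula with vanishing terms added, so that factorials of different numbers can be
    compared term by term. *)
Lemma logn_fact_wide N n : (n <= N)%N ->
  logn p n`! = (\sum_(1 <= k < N.+1) n %/ p ^ k)%N.
Proof.
move=> le_nN; rewrite logn_fact // [RHS](big_cat_nat _ (n := n.+1)) //=.
rewrite [X in (_ + X)%N]big_nat_cond [X in (_ + X)%N]big1 ?addn0 // => k.
case/andP=> /andP[lt_nk _] _; apply: divn_small.
exact: leq_trans lt_nk (ltnW (ltn_expl _ (prime_gt1 p_pr))).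
Qed.

(** For [k <= i] the power [p ^ k] divides [q], so the quotients add up; for [k > i] all of them
    vanish. *)
Lemma logn_fact_split i q r : q = (p ^ i)%N -> (q + r < p ^ i.+1)%N ->
  logn p (q + r)`! = logn p (q`! * r`!).
Proof.
move=> qE lt_n; rewrite lognM ?fact_gt0 //.
rewrite !(@logn_fact_wide (q + r)) ?leq_addr ?leq_addl // -big_split /=.
apply: eq_bigr => k _; have [le_ki|lt_ik] := leqP k i.
  by rewrite divnDl // qE dvdn_exp2l.
have lt_k : (q + r < p ^ k)%N.
  by rewrite (leq_trans lt_n) // leq_exp2l ?prime_gt1.
by rewrite !divn_small // (leq_ltn_trans _ lt_k) ?leq_addr ?leq_addl.
Qed.

(** The [k]-th Legendre term of the left side is [p] times that of [(p ^ i)!], except at [k = i.+1],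
    where it is [1] instead of [0]; the cyclic factor of order [p] accounts for this. *)
Lemma logn_fact_wreath i : logn p (p * p ^ i)`! = logn p ((p ^ i)`! ^ p * p).
Proof.
have p_gt1 := prime_gt1 p_pr; have p_gt0 := prime_gt0 p_pr.
rewrite lognM ?expn_gt0 ?fact_gt0 // lognX (logn_prime p p_pr) eqxx.
rewrite !(@logn_fact_wide (p * p ^ i)) ?leq_pmull //.
rewrite big_distrr /=.
(* The contribution [1] of the cyclic factor is written as a sum of indicators of [k = i.+1]. *)
rewrite -[X in (_ + X)%N](_ : \sum_(1 <= k < (p * p ^ i).+1) (k == i.+1) = 1)%N.
  rewrite -big_split /=; apply: eq_bigr => k _; rewrite -expnS.
  case: (ltngtP k i.+1) => [lt_k|lt_k|->].
  - by rewrite addn0 expnS muln_divA // dvdn_exp2l.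
  - rewrite !divn_small ?muln0 // ltn_exp2l //; exact: ltn_trans lt_k.
  by rewrite divnn expn_gt0 p_gt0 divn_small ?muln0 // ltn_exp2l.
rewrite (big_cat_nat _ (n := i.+1)) //=; last first.
  by rewrite ltnS ltnW // -expnS ltnW // ltn_expl.
rewrite big_nat_cond big1 ?add0n => [|k /andP[/andP[_ lt_k] _]]; last by rewrite ltn_eqF.
rewrite big_ltn ?eqxx; last by rewrite ltnS -expnS ltnW // ltn_expl.
by rewrite big_nat_cond big1 ?addn0 // => k /andP[/andP[lt_k _] _]; rewrite gtn_eqF.
Qed.

Lemma index_pchar (F : fieldType) a b : p \in [pchar F] ->
    (0 < a)%N -> (b %| a)%N -> logn p a = logn p b ->
  (a %/ b)%N%:R != 0 :> F.
Proof.
move=> charF a_gt0 dv_ba eq_log; rewrite -(dvdn_pcharf charF).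
have b_gt0 : (0 < b)%N := dvdn_gt0 a_gt0 dv_ba.
have ab_gt0 : (0 < a %/ b)%N by rewrite divn_gt0 // dvdn_leq.
have := logn_div p dv_ba; rewrite eq_log subnn => log0.
apply/negP=> dv_p; move: log0; apply/eqP.
by rewrite -lt0n logn_gt0 mem_primes p_pr ab_gt0.
Qed.

End Index.

Lemma card_perms (T : finType) : #|{perm T}| = (#|T|)`!.
Proof.
rewrite -(cardsT T) -card_perm; apply: eq_card => s.
by rewrite inE; apply/esym/subsetP=> x; rewrite inE.
Qed.

(** * Splittable modules are algebraic *)

Section SplittableModules.

Variables (F : fieldType) (p : nat).
Hypothesis charF : p \in [pchar F].

Let p_pr : prime p := pcharf_prime charF.

(** Injections from arbitrary finite types replace subsets of [Omega], so that successive
    restrictions correspond to composed injections. *)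
Definition splittable (Omega : finType) (M : frep F {perm Omega}) :=
  forall (Q : finType) (f : Q -> Omega) (f_inj : injective f),
  separable (pull (embM f_inj) M).

Lemma pull_emb (Q R Omega : finType) (f : Q -> Omega) (e : R -> Q)
    (f_inj : injective f) (e_inj : injective e) (fe_inj : injective (f \o e))
    (M : frep F {perm Omega}) :
  pull (embM fe_inj) M <| pull (embM e_inj) (pull (embM f_inj) M) /\
  pull (embM e_inj) (pull (embM f_inj) M) <| pull (embM fe_inj) M.
Proof.
apply: ret_pull_pull => h; apply/esym/emb_eq => [y|z out].
  by rewrite /= !emb_im.
case: (embP f z) => [y Ez|out']; last by rewrite emb_out.
rewrite Ez emb_im emb_out // => x; apply: contraNneq (out x) => /= ->.
by rewrite Ez.
Qed.

Lemma splittable_pull (Q Omega : finType) (f : Q -> Omega) (f_inj : injective f)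
    (M : frep F {perm Omega}) :
  splittable M -> splittable (pull (embM f_inj) M).
Proof.
move=> splitM R e e_inj; have fe_inj := inj_comp f_inj e_inj.
have [fe1 fe2] := pull_emb f_inj e_inj fe_inj M.
exact: ret_separable fe2 fe1 (splitM _ _ fe_inj).
Qed.

(** A relabelling of the points is treated as the inclusion of a subgroup of index 1. *)
Lemma algf_emb (Q Omega : finType) (f : Q -> Omega) (f_inj : injective f)
    (M : frep F {perm Omega}) :
  #|Q| = #|Omega| -> algf (pull (embM f_inj) M) -> algf M.
Proof.
move=> eq_card; apply: algf_pull; first exact: emb_inj.
rewrite !card_perms eq_card divnn fact_gt0.
exact: oner_neq0.
Qed.

Lemma bij_of_card (Q Omega : finType) :
  #|Q| = #|Omega| -> exists f : Q -> Omega, injective f.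
Proof.
move=> eq_card; exists (fun y => enum_val (cast_ord eq_card (enum_rank y))).
by move=> y y' /enum_val_inj/cast_ord_inj/enum_rank_inj.
Qed.

Lemma algf_trivial_group (gT : finGroupType) (M : frep F gT) :
  (forall g : gT, g = 1%g) -> algf M.
Proof.
move=> triv_g; exists (triv F gT unit) => j; exists (fB (tpow M j)).
apply: (ret_bij (f := fun x : fB (tpow M j) =>
  (tt, x) : fB (tens (triv F gT unit) (triv F gT (fB (tpow M j)))))).
  by exists snd => // -[[]].
by move=> g a b; rewrite [g]triv_g !fR1 !ent1 xpair_eqE eqxx.
Qed.

(** * Prime powers: the imprimitive wreath product *)

Section PowerOfPrime.
Variables (Q : finType) (M : frep F {perm ('Z_p * Q)}).

Local Notation K := 'Z_p.
Local Notation to := ('R%act : {action K &-> K}).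
Local Notation wr := (wreath {perm Q} to).

Definition imprim_fun (g : wr) (z : K * Q) : K * Q :=
  (to z.1 g.2, g.1 z.1 z.2).

Lemma imprim_inj g : injective (imprim_fun g).
Proof.
move=> [x y] [x' y'] eq_z; have /mulIg Ex : (x * g.2 = x' * g.2)%g := congr1 fst eq_z.
by move: eq_z; rewrite Ex => /(congr1 snd) /= /perm_inj->.
Qed.

Definition imprim (g : wr) : {perm (K * Q)} := perm (@imprim_inj g).

Lemma imprimM : {morph imprim : g g' / (g * g')%g}.
Proof.
move=> g g'; apply/permP=> -[x y]; rewrite permM !permE /imprim_fun /=.
rewrite !ffunE permM; congr (_, _); exact: mulgA.
Qed.

Lemma imprim_injective : Q -> injective imprim.
Proof.
move=> y0 [h k] [h' k'] eq_g.
have E x y : (to x k, h x y) = (to x k', h' x y).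
  by have /permP/(_ (x, y)) := eq_g; rewrite !permE.
congr (_, _); last by have /mulgI : (1 * k = 1 * k')%g := congr1 fst (E 1%g y0).
by apply/ffunP=> x; apply/permP=> y; exact: (congr1 snd (E x y)).
Qed.

Lemma coord_inj (x : K) : injective (fun y : Q => (x, y)).
Proof. by move=> y y' /(congr1 snd). Qed.

Lemma imprim_wcoord x h : imprim (wcoord to x h) = emb (@coord_inj x) h.
Proof.
apply: emb_eq => [y|[x' y'] out]; rewrite permE /imprim_fun /= ffunE mulg1.
  by rewrite eqxx.
case: eqP => [Ex|_]; last by rewrite perm1.
by have := out y'; rewrite Ex eqxx.
Qed.

Lemma algf_prime_power i :
    #|Q| = (p ^ i)%N ->
    (forall N : frep F {perm Q}, splittable N -> algf N) ->
  splittable M -> algf M.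
Proof.
move=> cardQ algQ splitM.
have /card_gt0P[y0 _] : (0 < #|Q|)%N by rewrite cardQ expn_gt0 prime_gt0.
have cardK : #|K| = p by rewrite card_ord Zp_cast ?prime_gt1.
apply: (algf_pull (phiM := imprimM)); first exact: imprim_injective.
  have card_wr : #|{: wr}| = ((p ^ i)`! ^ p * p)%N.
    by rewrite [LHS]card_prod card_ffun card_perms cardQ cardK.
  apply: (index_pchar p_pr charF); rewrite ?card_perms ?fact_gt0 //.
    rewrite -(card_perms (K * Q)%type).
    by rewrite -(card_cosets imprimM (imprim_injective y0)) dvdn_mull.
  by rewrite card_wr card_prod cardK cardQ logn_fact_wreath.
have [T finT] := cyclic_finite_type charF.
have [c1 c2] : pull (wcoordM to 1%g) (pull imprimM M) <|
      pull (embM (@coord_inj (1%g : K))) M /\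
    pull (embM (@coord_inj (1%g : K))) M <|
      pull (wcoordM to 1%g) (pull imprimM M).
  have [] := @ret_pull_pull F _ _ _ _ _ _ (wcoordM to (1%g : K)) imprimM
    (embM (@coord_inj (1%g : K))) M; last by split.
  by move=> h; rewrite imprim_wcoord.
apply: (@algf_wreath _ _ _ _ _ (1%g : K) _ T) => [x|||A j].
- by exists x^-1%g; rewrite /= mulgV.
- exact: ret_separable c1 c2 (splitM _ _ _).
- apply: algf_ret c1 _; apply: algQ; exact: splittable_pull.
exact: finT.
Qed.

End PowerOfPrime.

(** * Other degrees: the product of two symmetric groups *)

Section YoungSubgroup.
Variables (Q R : finType) (M : frep F {perm (Q + R)}).

Definition trivial_act (x : unit) (k : {perm R}) : unit := x.

Lemma trivial_act1 x : trivial_act x 1%g = x. Proof. by []. Qed.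

Lemma trivial_actM x k k' :
  trivial_act x (k * k')%g = trivial_act (trivial_act x k) k'.
Proof. by []. Qed.

Local Notation to := (TotalAction trivial_act1 trivial_actM).
Local Notation wr := (wreath {perm Q} to).

Definition young_fun (g : wr) (z : Q + R) : Q + R :=
  match z with inl y => inl (g.1 tt y) | inr y => inr (g.2 y) end.

Lemma young_fun_inj g : injective (young_fun g).
Proof. by move=> [y|y] [y'|y'] //= [/perm_inj->]. Qed.

Definition young (g : wr) : {perm (Q + R)} := perm (@young_fun_inj g).

Lemma youngM : {morph young : g g' / (g * g')%g}.
Proof.
move=> g g'; apply/permP=> -[y|y]; rewrite permM !permE /= ?permM //.
by rewrite ffunE permM.
Qed.

Lemma young_injective : injective young.
Proof.
move=> [h k] [h' k'] eq_g.
have E z : young_fun (h, k) z = young_fun (h', k') z.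
  by have /permP/(_ z) := eq_g; rewrite !permE.
congr (_, _); last by apply/permP=> y; have [] := E (inr y).
by apply/ffunP=> -[]; apply/permP=> y; have [] := E (inl y).
Qed.

Lemma inl_injective : injective (@inl Q R). Proof. by move=> y y' []. Qed.
Lemma inr_injective : injective (@inr Q R). Proof. by move=> y y' []. Qed.

Lemma young_wcoord h : young (wcoord to tt h) = emb inl_injective h.
Proof.
apply: emb_eq => [y|[y|y] out]; rewrite permE /= ?ffunE //= ?perm1 //.
by have := out y; rewrite eqxx.
Qed.

Lemma young_wtop k : young (wtop {perm Q} to k) = emb inr_injective k.
Proof.
apply: emb_eq => [y|[y|y] out]; rewrite permE /= ?ffunE ?perm1 //.
by have := out y; rewrite eqxx.
Qed.

Lemma algf_young i :
    #|Q| = (p ^ i)%N -> (#|Q| + #|R| < p ^ i.+1)%N ->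
    (forall N : frep F {perm Q}, splittable N -> algf N) ->
    (forall N : frep F {perm R}, splittable N -> algf N) ->
  splittable M -> algf M.
Proof.
move=> cardQ lt_card algQ algR splitM.
apply: (algf_pull (phiM := youngM)); first exact: young_injective.
  have card_wr : #|{: wr}| = ((#|Q|)`! * (#|R|)`!)%N.
    by rewrite [LHS]card_prod card_ffun !card_perms card_unit expn1.
  apply: (index_pchar p_pr charF); rewrite ?card_perms ?fact_gt0 //.
    rewrite -(card_perms (Q + R)%type).
    by rewrite -(card_cosets youngM young_injective) dvdn_mull.
  by rewrite card_wr card_sum (logn_fact_split p_pr cardQ).
have [c1 c2] := @ret_pull_pull F _ _ _ _ _ _ (wcoordM to tt) youngM
  (embM inl_injective) M (fun h => esym (young_wcoord h)).
have [d1 d2] := @ret_pull_pull F _ _ _ _ _ _ (wtopM {perm Q} to) youngM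
  (embM inr_injective) M (fun h => esym (young_wtop h)).
have [T algT] : algf (pull (wtopM {perm Q} to) (pull youngM M)).
  by apply: algf_ret d2 _; apply: algR; apply: splittable_pull.
apply: (@algf_wreath _ _ _ _ _ tt _ T) => [[]|||A j].
- by exists 1%g.
- exact: ret_separable c2 c1 (splitM _ _ _).
- by apply: algf_ret c2 _; apply: algQ; apply: splittable_pull.
have [B TB] := algT j; exists (B * {ffun unit -> A})%type.
(* Over a point the top group permutes nothing, so this permutation module is trivial and only
   contributes to the multiplicity. *)
have permA : perm_rep {perm Q} to F A <| triv F _ {ffun unit -> A}.
  apply: (ret_bij (f := (id : fB (perm_rep {perm Q} to F A) ->
    fB (triv F {perm R} {ffun unit -> A})))); first by exists id.
  move=> k a b; transitivity (ent (tpw (fun _ : unit => 1%:M : 'M[F]_#|A|) id) a b).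
    by congr (ent _ a b); apply: eq_tpw.
  by rewrite tpw1.
apply: ret_trans (ret_tens permA TB) _.
apply: ret_trans (ret_tensC _ _) _.
exact: ret_triv_tensC.
Qed.

End YoungSubgroup.

Lemma algf_splittable (Omega : finType) (M : frep F {perm Omega}) :
  splittable M -> algf M.
Proof.
have [n] := ubnP #|Omega|; elim: n Omega M => // n IHn Omega M /ltnSE le_n splitM.
have [le1|gt1] := leqP #|Omega| 1.
  apply: algf_trivial_group => g.
  apply: (perm_on_id (S := setT)); last by rewrite cardsT.
  by apply/subsetP=> x; rewrite inE.
have p_gt1 := prime_gt1 p_pr.
set m := #|Omega| in le_n gt1; pose i := trunc_log p m.
have m_gt0 : (0 < m)%N := ltnW gt1.
have [le_q lt_q] : (p ^ i <= m)%N /\ (m < p ^ i.+1)%N.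
  by have /andP[] := trunc_log_bounds p_gt1 m_gt0.
have IH (Q : finType) (N : frep F {perm Q}) :
    (#|Q| < m)%N -> splittable N -> algf N.
  by move=> lt_Q; apply: IHn; apply: leq_trans lt_Q le_n.
have reduce (Omega0 : finType) : #|Omega0| = m ->
    (forall N : frep F {perm Omega0}, splittable N -> algf N) -> algf M.
  move=> card0 alg0; have [f f_inj] := bij_of_card card0.
  by apply: (algf_emb (f_inj := f_inj)) => //; apply/alg0/splittable_pull.
have [eq_q|ne_q] := eqVneq (p ^ i)%N m.
  (* Exponent [0] would give [m = 1]. Otherwise the points are arranged in [p] blocks, each of size
     the preceding power of [p]. *)
  case: i le_q lt_q eq_q => [|i] le_q lt_q eq_q; first by rewrite -eq_q in gt1.
  have card0 : #|{: 'Z_p * 'I_(p ^ i)}| = m.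
    by rewrite card_prod !card_ord Zp_cast // -expnS.
  apply: (reduce _ card0) => N; apply: (@algf_prime_power _ _ i); first exact: card_ord.
  by move=> N'; apply: IH; rewrite card_ord -eq_q ltn_exp2l.
have lt_qm : (p ^ i < m)%N by rewrite ltn_neqAle ne_q.
have card0 : #|{: 'I_(p ^ i) + 'I_(m - p ^ i)}| = m.
  by rewrite card_sum !card_ord subnKC.
apply: (reduce _ card0) => N; apply: (@algf_young _ _ _ i).
- exact: card_ord.
- by rewrite !card_ord subnKC.
- by move=> N'; apply: IH; rewrite card_ord.
move=> N'; apply: IH; rewrite card_ord -{2}(subn0 m) ltn_sub2l //.
by rewrite expn_gt0 prime_gt0.
Qed.

End SplittableModules.

(** * From Young subgroups to symmetric groups of subsets *)

Definition initial_composition (n q : nat) : seq nat := q :: nseq (n - q) 1%N.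

Lemma composition_initial n q :
  (0 < q)%N -> (q <= n)%N -> composition n (initial_composition n q).
Proof.
move=> q_gt0 le_qn; rewrite /composition /= q_gt0 all_nseq orbT /=.
by rewrite sumn_nseq mul1n subnKC.
Qed.

(** All blocks after the first consist of one point, so their symmetric groups are trivial and the
    Young subgroup is its first factor. *)
Lemma young_initial n q (g : 'S_n) :
  (g \in young_subgroup n (initial_composition n q)) =
  perm_on [set i : 'I_n | (i < q)%N] g.
Proof.
have block0 : young_block n (initial_composition n q) 0 = [set i : 'I_n | (i < q)%N].
  by apply/setP=> i; rewrite !inE /= take0 /= addn0.
rewrite /young_subgroup bigprodGE; apply/idP/idP => [|onq].
  pose G := perm.Sym_group [set i : 'I_n | (i < q)%N].
  suffices sub : <<\bigcup_(k < size (initial_composition n q))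
      perm.Sym_group (young_block n (initial_composition n q) k)>> \subset G.
    by move/(subsetP sub); rewrite inE.
  rewrite gen_subG; apply/bigcupsP=> -[[|k] lt_k] _ /=.
    by rewrite block0.
  apply/subsetP=> s; rewrite !inE => s_on.
  suffices -> : s = 1%g by apply: perm_on1.
  apply: perm_on_id s_on _; rewrite leqNgt; apply/negP=> /card_gt1P[i [j []]].
  have le_k : (k.+1 <= n - q)%N by move: lt_k; rewrite /= size_nseq.
  rewrite !inE /= !take_nseq ?(ltnW le_k) // !sumn_nseq !mul1n addnS !ltnS.
  rewrite -!eqn_leq => /eqP Ei /eqP Ej; case/eqP.
  by apply: val_inj; rewrite /= -Ei -Ej.
apply/mem_gen/bigcupP; exists (ord0 : 'I_(size (initial_composition n q))) => //.
by rewrite inE block0.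
Qed.

(** Semisimplicity over a Young subgroup is given for initial segments of ['I_n]; an arbitrary [f]
    is conjugate by [extend_perm] to the embedding [e] onto such a segment. *)
Lemma completely_splittable_splittable (k : closedFieldType) (n : nat)
    (M : representation k [set: 'S_n]) :
  (0 < n)%N -> completely_splittable M -> splittable (frep_of M).
Proof.
move=> n_gt0 [_ ssM] Q f f_inj.
(* Parts of a composition are positive, so for empty [Q] the trivial group is taken as [S_1]. *)
pose q := maxn #|Q| 1.
have le_Q : (#|Q| <= n)%N by rewrite -[n in (_ <= n)%N]card_ord; apply: leq_card f_inj.
have q_gt0 : (0 < q)%N by rewrite leq_max orbT.
have le_qn : (q <= n)%N by rewrite geq_max le_Q.
have [{}ssM] := ssM _ (composition_initial q_gt0 le_qn).
pose e (y : Q) : 'I_n := widen_ord le_Q (enum_rank y).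
have e_inj : injective e.
  by move=> y y' /(congr1 val) /= /val_inj/enum_rank_inj.
have e_im : forall g, reflect (exists h, g = emb e_inj h)
    (g \in young_subgroup n (initial_composition n q)).
  move=> g; rewrite young_initial; apply: (iffP idP) => [g_on|[h ->]].
    have [g1|q'1] := leqP #|Q| 0.
      have -> : g = 1%g; last by exists 1%g; rewrite (emb1 e_inj).
      apply: perm_on_id g_on _; rewrite leqNgt; apply/negP=> /card_gt1P[i [j []]].
      have -> : q = 1%N by apply/maxn_idPr; apply: leq_trans g1 _.
      by rewrite !inE !ltnS !leqn0 => /eqP i0 /eqP j0 /eqP; case;
        apply: val_inj; rewrite /= i0.
    apply: emb_onto => z out; apply: (out_perm g_on); rewrite inE.
    rewrite /q (maxn_idPl q'1); apply/negP=> lt_z.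
    have /eqP := out (enum_val (Ordinal lt_z)); case; apply: val_inj.
    by rewrite /= enum_valK.
  apply/subsetP=> z; apply: contraR; rewrite inE => z_out; apply/eqP/emb_out => y.
  apply: contraNneq z_out => <-; rewrite (leq_trans (ltn_ord (enum_rank y))) //.
  exact: leq_maxl.
have sep_e : separable (pull (embM e_inj) (frep_of M)).
  have sep := separable_res (embM e_inj) (emb_inj (f_inj := e_inj)) e_im ssM.
  exact: sep.
have [s sE] := extend_perm e_inj f_inj.
have conj h : (s * emb f_inj h = emb e_inj h * s)%g.
  apply/permP=> z; rewrite !permM; case: (embP e z) => [y ->|out].
    by rewrite sE !emb_im sE.
  rewrite (emb_out e_inj h out) emb_out // => y; rewrite -sE (inj_eq perm_inj).
  exact: out.
apply: ret_separable sep_e; first exact: ret_conj conj.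
apply: (@ret_conj _ _ _ _ _ _ _ _ s^-1%g) => h.
by rewrite -{1}(mulgK s (emb e_inj h)) -conj !mulgA mulVg mul1g.
Qed.

Theorem corollary4p1p4 (k : closedFieldType) (p : nat)
    (char_k : p \in [pchar k]%R) (n : nat) (n_gt0 : (0 < n)%N)
    (M : representation k [set: 'S_n]) :
  completely_splittable M -> algebraic_module M.
Proof.
move=> csM; apply: algf_algebraic; apply: (algf_splittable char_k).
exact: completely_splittable_splittable csM.
Qed.
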